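(* For any integer $k\ge 3$ and constant $\tfrac{1}{k}<\eta\le 1$, there exists an $\alpha>0$ such that for all sufficiently large $n\in \mathbb{N}$, any $n$-vertex graph $G$ with $\delta(G)\ge \eta n$ and $\alpha_{k-1}(G)\le \alpha n$ contains an $\eta$-quasiperfect $K_k$-tiling, and hence an $\eta$-quasiperfect $F$-tiling for any $k$-vertex graph $F$.
   Context: Graphs are finite and simple; $\delta(G)$ is the minimum degree and $K_k$ the complete graph on $k$ vertices. For $r\in\mathbb{N}$, $\alpha_r(G)$ is the largest size of a set $U\subset V(G)$ such that $G[U]$ contains no copy of $K_r$. An $F$-tiling in $G$ is a collection of vertex-disjoint copies of $F$ in $G$ (not necessarily induced). For $\eta\in(0,1]$ and a $k$-vertex graph $F$, an $F$-tiling in $G$ is $\eta$-quasiperfect if it covers all but at most $\lfloor 1/\eta\rfloor (k-1)$ vertices of $G$. *)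

(* Defs.v *)
From mathcomp Require Import all_boot all_order all_algebra.
From mathcomp Require Import reals.

Set Implicit Arguments.
Unset Strict Implicit.
Unset Printing Implicit Defensive.

Import Order.TTheory GRing.Theory Num.Theory.

Record sgraph := SGraph {
  vertex :> finType;
  adj : rel vertex;
  adj_sym : symmetric adj;
  adj_irrefl : irreflexive adj }.

Section Complete.
Variable k : nat.

Lemma neq_ord_sym : symmetric (fun i j : 'I_k => i != j).
Proof. by move=> i j; rewrite eq_sym. Qed.

Lemma neq_ord_irrefl : irreflexive (fun i j : 'I_k => i != j).
Proof. by move=> i; rewrite eqxx. Qed.

Definition complete := SGraph neq_ord_sym neq_ord_irrefl.
End Complete.

Section Induced.
Variables (G : sgraph) (U : {set G}).

Definition induced_adj : rel {x : G | x \in U} :=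
  fun x y => adj (val x) (val y).

Lemma induced_adj_sym : symmetric induced_adj.
Proof. by move=> x y; apply: adj_sym. Qed.

Lemma induced_adj_irrefl : irreflexive induced_adj.
Proof. by move=> x; apply: adj_irrefl. Qed.

Definition induced := SGraph induced_adj_sym induced_adj_irrefl.
End Induced.

Definition degree (G : sgraph) (x : G) : nat := #|[set y | adj x y]|.

(* The default value #|G| exceeds every degree, so it only matters for the
   graph without vertices, whose minimum degree is 0. *)
Definition min_degree (G : sgraph) : nat :=
  \big[minn/#|G|]_(x : G) degree x.

(* A copy of F in G is given by an embedding of F in G; it need not be
   induced. *)
Definition is_copy (F G : sgraph) (f : {ffun F -> G}) : bool :=
  injectiveb f && [forall x, forall y, adj x y ==> adj (f x) (f y)].

Definition contains_copy (F G : sgraph) : bool :=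
  [exists f : {ffun F -> G}, is_copy f].

Definition alpha_num (r : nat) (G : sgraph) : nat :=
  \max_(U : {set G} | ~~ contains_copy (complete r) (induced U)) #|U|.

(* Two embeddings in a tiling with the same image would not be disjoint (when F
   has a vertex), so a tiling uses each copy through one embedding only. *)
Definition is_tiling (F G : sgraph) (M : {set {ffun F -> G}}) : Prop :=
  (forall f, f \in M -> is_copy f) /\
  (forall f g, f \in M -> g \in M -> f != g ->
     [disjoint f @: [set: F] & g @: [set: F]]).

Definition covered (F G : sgraph) (M : {set {ffun F -> G}}) : {set G} :=
  \bigcup_(f in M) f @: [set: F].

(* truncn is the floor, as a natural number, of a nonnegative real. *)
Definition quasiperfect (R : realType) (eta : R) (F G : sgraph)
    (M : {set {ffun F -> G}}) : Prop :=
  #|~: covered M| <= Num.truncn (1 / eta)%R * (#|F| - 1).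

Definition has_quasiperfect_tiling (R : realType) (eta : R) (F G : sgraph) :
    Prop :=
  exists2 M : {set {ffun F -> G}}, is_tiling M & quasiperfect eta M.

(* Main.v *)
Require Import Defs.
From mathcomp Require Import all_boot all_order all_algebra.
From mathcomp Require Import reals.
From mathcomp Require Import zify ring lra.

(* A set of more than alpha n vertices contains a (k-1)-clique, so a large neighbourhood of a
   vertex gives k-cliques through that vertex.

   Almost perfect tilings: let L be the set of vertices missed by a maximum tiling. A vertex of L
   has few neighbours in L, so, as its degree exceeds n/k, it has on average more than one
   neighbour in a tile, and some tile has two vertices with many neighbours in L. Both extend to
   tiles by (k-1)-cliques of L, a contradiction unless |L| = O(alpha n).

   Absorption: as (q+1) eta > 1 for q the floor of 1/eta, any q+1 vertices contain two with many
   common neighbours. Hence the vertices fall into at most q classes such that two vertices of a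
   class can be exchanged robustly: outside any small set there is a gadget that can be tiled
   together with either of them. Following Nenadov and Pehova, gadgets are arranged along
   Montgomery's robustly matchable bipartite graph; this gives, for every class, an absorbing
   set that can be tiled together with any subset of prescribed size of a small set X of the class.
   Choosing X so that almost every vertex has many neighbours in the union of the sets X, the few
   vertices missed by an almost perfect tiling are covered with the help of X.

   Divisibility: between every class i and some class f i there are many cliques with one vertex
   in i and k-1 in f i, and conversely. Modulo the lattice spanned by the class vectors of these
   cliques every vector is congruent to one with entries less than k, so that the prescribed sizes
   can be attained by removing such cliques and at most k-1 vertices from every class. *)

Set Implicit Arguments.
Unset Strict Implicit.
Unset Printing Implicit Defensive.

(** * Hall's theorem and random expanders *)

Section FiniteSets.
Variable T : finType.

Lemma exists_subset_card m (A : {set T}) : m <= #|A| ->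
  exists2 B : {set T}, B \subset A & #|B| = m.
Proof.
move=> mA; exists [set x in take m (enum A)].
  by apply/subsetP => x; rewrite inE => /mem_take; rewrite mem_enum.
by rewrite cardsE (card_uniqP _) ?take_uniq ?enum_uniq // size_take_min -cardE; apply/minn_idPl.
Qed.

Lemma exists_superset_card m (A C : {set T}) : A \subset C -> #|A| <= m <= #|C| ->
  exists B : {set T}, [/\ A \subset B, B \subset C & #|B| = m].
Proof.
move=> AC /andP[Am mC].
have [B BCA cB] : exists2 B : {set T}, B \subset C :\: A & #|B| = m - #|A|.
  by apply: exists_subset_card; rewrite cardsDS // leq_sub2r.
exists (A :|: B); split; rewrite ?subsetUl // ?subUset ?AC ?(subset_trans BCA) ?subsetDl //.
move: BCA; rewrite subsetD => /andP[_ dBA].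
by rewrite cardsU cB setIC disjoint_setI0 // cards0; lia.
Qed.

Lemma card_bigcup_leq (I : finType) (D : pred I) (F : I -> {set T}) :
  #|\bigcup_(i | D i) F i| <= \sum_(i | D i) #|F i|.
Proof.
elim/big_rec2: _ => [|i m A _ h]; first by rewrite cards0.
by rewrite (leq_trans (leq_card_setU _ _)) ?leq_add2l.
Qed.

End FiniteSets.

Section Hall.
Variables P Q : finType.

Definition nbr (E : P -> Q -> bool) (A : {set P}) : {set Q} :=
  [set y | [exists x in A, E x y]].

Lemma nbrP (E : P -> Q -> bool) (A : {set P}) y :
  reflect (exists2 x, x \in A & E x y) (y \in nbr E A).
Proof. by rewrite inE; apply: (iffP exists_inP). Qed.

Lemma nbrU E A B : nbr E (A :|: B) = nbr E A :|: nbr E B.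
Proof.
apply/setP => y; rewrite in_setU; apply/nbrP/orP.
  by case=> x; rewrite in_setU => /orP[xA|xB] h; [left|right]; apply/nbrP; exists x.
by case=> /nbrP[x xA h]; exists x; rewrite // in_setU xA ?orbT.
Qed.

Lemma nbrS E (A B : {set P}) : A \subset B -> nbr E A \subset nbr E B.
Proof.
move=> AB; apply/subsetP => y /nbrP[x xA h].
by apply/nbrP; exists x; rewrite ?(subsetP AB).
Qed.

(** Induction on $|D|$. If a nonempty proper subset $A$ is tight, $A$ is matched by itself and $D
    \setminus A$ outside the neighbourhood of $A$. Otherwise any edge can be fixed, since deleting
    its endpoint in $Q$ costs every other set at most one neighbour. [y0] makes [Q] inhabited, so
    that total functions exist. *)
Theorem hall (y0 : Q) (E : P -> Q -> bool) (D : {set P}) :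
    (forall A : {set P}, A \subset D -> #|A| <= #|nbr E A|) ->
  exists f : P -> Q, {in D &, injective f} /\ forall x, x \in D -> E x (f x).
Proof.
move: {2}#|D| (leqnn #|D|) => n; elim: n D E => [|n IH] D E.
  rewrite leqn0 cards_eq0 => /eqP-> _.
  by exists (fun=> y0); split=> x; rewrite ?inE.
move=> Dn hE.
have [/existsP[A /and4P[AD An0 AnD /eqP cA]]|loose] := boolP [exists A : {set P},
  [&& A \subset D, A != set0, A != D & #|nbr E A| == #|A|]].
  have ltA : #|A| < #|D| by rewrite proper_card // properEneq AnD.
  have [||f1 [i1 e1]] := IH A E; first by rewrite -ltnS (leq_trans ltA).
    by move=> B BA; apply: hE; apply: subset_trans AD.
  pose E' x y := E x y && (y \notin nbr E A).
  have [||f2 [i2 e2]] := IH (D :\: A) E'.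
  - have := cardsID A D; rewrite (setIidPr AD).
    by move: An0; rewrite -card_gt0; lia.
  - move=> B; rewrite subsetD => /andP[BD dBA].
    have := hE (A :|: B); rewrite subUset AD BD => /(_ isT).
    rewrite cardsU disjoint_setI0 1?disjoint_sym // cards0 subn0 nbrU.
    have -> : nbr E' B = nbr E B :\: nbr E A.
      apply/setP=> y; rewrite in_setD; apply/nbrP/andP.
        by case=> x xB /andP[h1 h2]; split=> //; apply/nbrP; exists x.
      by case=> h /nbrP[x xB h1]; exists x; rewrite // /E' h1.
    by rewrite cardsU cardsD cA setIC; lia.
  exists (fun x => if x \in A then f1 x else f2 x); split=> [x y xD yD|x xD].
    case: ifPn => xA; case: ifPn => yA; first exact: i1.
    - move=> eq12; have /andP[_ /negP[]] : E' y (f2 y) by apply: e2; rewrite inE yA yD.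
      by rewrite -eq12; apply/nbrP; exists x; rewrite ?e1.
    - move=> eq12; have /andP[_ /negP[]] : E' x (f2 x) by apply: e2; rewrite inE xA xD.
      by rewrite eq12; apply/nbrP; exists y; rewrite ?e1.
    by apply: i2; rewrite inE ?xA ?yA.
  case: ifPn => xA; first exact: e1.
  by have /andP[] : E' x (f2 x) by apply: e2; rewrite inE xA xD.
have [->|[x xD]] := set_0Vmem D; first by exists (fun=> y0); split=> x; rewrite ?inE.
have [y xy] : exists y, E x y.
  have : 0 < #|nbr E [set x]| by rewrite (leq_trans _ (hE _ _)) ?cards1 ?sub1set.
  by rewrite card_gt0 => /set0Pn[y /nbrP[x' /set1P->]]; exists y.
pose E' x' y' := E x' y' && (y' != y).
have [||f [fi fe]] := IH (D :\ x) E'.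
- by have := cardsD1 x D; rewrite xD; lia.
- move=> B BD; have [->|Bn0] := eqVneq B set0; first by rewrite cards0.
  have /subsetD1P[BD' xB] := BD.
  move: loose; rewrite negb_exists => /forallP/(_ B); rewrite BD' Bn0 /=.
  have -> /= : B != D by apply: contraNneq xB => ->.
  have -> : nbr E' B = nbr E B :\ y.
    apply/setP=> z; rewrite in_setD1; apply/nbrP/andP.
      by case=> x' xB' /andP[h1 h2]; split=> //; apply/nbrP; exists x'.
    by case=> h /nbrP[x' xB' h1]; exists x'; rewrite // /E' h1.
  by have := hE B BD'; have := cardsD1 y (nbr E B); lia.
exists (fun x' => if x' == x then y else f x'); split=> [x1 x2 x1D x2D|x1 x1D].
  have nf z : z \in D -> z != x -> f z != y.
    by move=> zD zx; have /andP[] : E' z (f z) by apply: fe; rewrite !inE zx.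
  case: eqP => [->|/eqP x1x]; case: eqP => [->//|/eqP x2x].
  - by move=> eqy; have := nf _ x2D x2x; rewrite -eqy eqxx.
  - by move=> eqy; have := nf _ x1D x1x; rewrite -eqy eqxx.
  by apply: fi; rewrite !inE ?x1x ?x2x.
case: eqP => [->//|/eqP x1x].
by have /andP[] : E' x1 (f x1) by apply: fe; rewrite !inE x1x.
Qed.
End Hall.


Section Expander.

Lemma ffact_leq_expn n a : n ^_ a <= n ^ a.
Proof.
rewrite ffact_prod -[X in n ^ X]card_ord -prod_nat_const.
by apply: leq_prod => i _; rewrite leq_subr.
Qed.

(** A weak Stirling bound: $\binom{2a}{a} \le 4^a$, while $\binom{2a}{a}\, a! = (a+1)\cdots(2a) \ge
    a^a$. *)
Lemma expn_leq_fact a : a ^ a <= 4 ^ a * a`!.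
Proof.
have h : 'C(a.*2, a) <= 4 ^ a.
  rewrite -[4]/(2 ^ 2) -expnM mul2n -[X in 2 ^ X](card_ord a.*2) -cardsT -card_powerset.
  by rewrite -[X in 'C(X, _)](card_ord a.*2) -card_draws subset_leq_card //; apply/subsetP => A _; rewrite powersetE subsetT.
apply: leq_trans (_ : 'C(a.*2, a) * a`! <= _); last by rewrite leq_mul2r h orbT.
rewrite bin_ffact ffact_prod -{2}[a]card_ord -prod_nat_const.
by apply: leq_prod => i _; have := ltn_ord i; lia.
Qed.

(** Two uses of [expn_leq_fact] cost $16^a$, and $p \le 2n$ costs $2^a$. *)
Lemma bin_expn_bound p n a : p <= n.*2 ->
  'C(p, a) * 'C(n, a) * a ^ a.*2 <= 32 ^ a * n ^ a.*2.
Proof.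
move=> pn.
apply: leq_trans (_ : 'C(p, a) * 'C(n, a) * (4 ^ a * a`!) ^ 2 <= _).
  by rewrite leq_mul2l -muln2 expnM leq_exp2r // expn_leq_fact orbT.
have -> : 'C(p, a) * 'C(n, a) * (4 ^ a * a`!) ^ 2 = 16 ^ a * (p ^_ a * n ^_ a).
  by rewrite -!bin_ffact -[16]/(4 ^ 2) expnMn [(4 ^ a) ^ 2]expnAC;
  move: ((4 ^ 2) ^ a) => c; move: ('C(p, a)) ('C(n, a)) (a`!) => x y z; ring.
rewrite -[32]/(16 * 2) expnMn -mulnA leq_mul2l.
apply/orP; right; rewrite -addnn expnD mulnA -expnMn mul2n leq_mul //; last exact: ffact_leq_expn.
by apply: leq_trans (ffact_leq_expn _ _) _; case: (a) => // a'; rewrite leq_exp2r.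
Qed.

Lemma scaled_pow_bound c d m r a n : 0 < d -> m * c ^ r <= d ^ r ->
  d * a <= c * n -> 0 < r -> m * a ^ r <= n ^ r.
Proof.
move=> d0 mcd h r0; have : (d * a) ^ r <= (c * n) ^ r by rewrite leq_exp2r.
have : 0 < d ^ r by rewrite expn_gt0 d0.
rewrite !expnMn; move: (d ^ r) (c ^ r) mcd => L K KL L0 {}h.
by rewrite -(leq_pmul2l L0); nia.
Qed.

(** The product beside $4^a$ bounds the number of maps [P * 'I_19 -> Q] that confine some $a$-set of
    $P$ to an $a$-set of $Q$. Of the 19 exponents, 2 pay for the binomials through [bin_expn_bound];
    the other 17 give $(3/4)^{17a} \le 128^{-a}$, which leaves $4^{-a}$. *)
Lemma expander_term p n a : p <= n.*2 -> 4 * a <= 3 * n -> a <= p ->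
  4 ^ a * ('C(p, a) * 'C(n, a) * (a ^ (19 * a) * n ^ (19 * (p - a)))) <= n ^ (19 * p).
Proof.
move=> pn an ap.
have -> : n ^ (19 * p) = n ^ (17 * a) * n ^ a.*2 * n ^ (19 * (p - a)).
  by rewrite -!expnD; congr (_ ^ _); lia.
have -> : a ^ (19 * a) = a ^ (17 * a) * a ^ a.*2.
  by rewrite -expnD; congr (_ ^ _); lia.
have h1 := bin_expn_bound a pn.
have h2 : 128 ^ a * a ^ (17 * a) <= n ^ (17 * a).
  rewrite !expnM -expnMn; case: (a) an => // a' an; rewrite leq_exp2r //.
  have c : 128 * 3 ^ 17 <= 4 ^ 17 by clear; lia.
  exact: (@scaled_pow_bound 3 4 128 17 _ n isT c an isT).
have := leq_mul (leq_mul h2 h1) (leqnn (n ^ (19 * (p - a)))).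
have -> : 128 ^ a = 4 ^ a * 32 ^ a by rewrite -expnMn.
have : 0 < 32 ^ a by rewrite expn_gt0.
move: (4 ^ a) (32 ^ a) => x y y0.
move: (n ^ (17 * a)) (n ^ a.*2) (n ^ (19 * (p - a))) (a ^ (17 * a)) (a ^ a.*2) ('C(p, a)) ('C(n, a)).
move=> n1 n2 n3 a1 a2 c1 c2 h.
rewrite -(leq_pmul2r y0).
have -> : x * (c1 * c2 * (a1 * a2 * n3)) * y = x * y * a1 * (c1 * c2 * a2) * n3 by ring.
by have -> : n1 * n2 * n3 * y = n1 * (y * n2) * n3 by ring.
Qed.

Lemma geometric_sum_bound (t : nat -> nat) N m : 0 < N ->
  (forall a, 0 < a <= m -> 4 ^ a * t a <= N) -> \sum_(1 <= a < m.+1) t a < N.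
Proof.
move=> N0 ht.
(* The partial sums are at most $N(1-4^{-m})/3$; denominators are cleared. *)
have : 3 * 4 ^ m * (\sum_(1 <= a < m.+1) t a) + N <= N * 4 ^ m.
  elim: m ht => [|m IH] ht; first by rewrite big_geq // expn0; lia.
  rewrite big_nat_recr //= mulnDr.
  have := ht m.+1 (leqnn _); have := IH _; rewrite expnS.
  move: (4 ^ m) (t m.+1) (\sum_(1 <= a < m.+1) t a) => x y z h1 h2.
  have {}h1 : 3 * x * z + N <= N * x.
    by apply: h1 => a /andP[a0 am]; apply: ht; rewrite a0 leqW.
  nia.
have : 0 < 4 ^ m by rewrite expn_gt0.
move: (4 ^ m) (\sum_(1 <= a < m.+1) t a) => x z; nia.
Qed.

Variables P Q : finType.

Lemma card_confined (I : finType) (A : {set P}) (B : {set Q}) :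
  #|[set f : {ffun P * I -> Q} | [forall x in A, forall i, f (x, i) \in B]]|
  = #|B| ^ (#|I| * #|A|) * #|Q| ^ (#|I| * (#|P| - #|A|)).
Proof.
pose F (p : P * I) := [pred y | (p.1 \in A) ==> (y \in B)].
rewrite (_ : #|_| = #|family F|); last first.
  apply: eq_card => f; rewrite inE; apply/forall_inP/familyP => h.
    move=> [x i]; rewrite /F inE /=; apply/implyP => xA; exact: (forallP (h x xA)).
  by move=> x xA; apply/forallP => i; have := h (x, i); rewrite /F inE /= xA.
rewrite card_family foldrE big_map big_enum /=.
rewrite -(pair_bigA _ (fun x i => #|F (x, i)|)) /= (bigID (mem A)) /=.
congr (_ * _).
  under eq_bigr => x xA.
    under eq_bigr => i _.
      rewrite (_ : #|F (x, i)| = #|B|); last by apply: eq_card => y; rewrite inE /= xA.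
    over.
    rewrite prod_nat_const.
  over.
  by rewrite prod_nat_const -expnM.
under eq_bigr => x xA.
  under eq_bigr => i _.
    rewrite (_ : #|F (x, i)| = #|Q|); last by apply: eq_card => y; rewrite inE /= (negbTE xA).
  over.
  rewrite prod_nat_const.
over.
rewrite (eq_bigl (mem (~: A))) => [|x]; last by rewrite !inE.
by rewrite prod_nat_const -expnM cardsCs setCK.
Qed.

(** Union bound, with counting in place of probability: by [card_confined] and [expander_term],
    fewer than all maps send some $A$ in the given range into a set smaller than $A$. *)
Lemma expander_exists : #|P| <= #|Q|.*2 ->
  exists f : {ffun P * 'I_19 -> Q}, forall A : {set P}, 4 * #|A| <= 3 * #|Q| ->
    #|A| <= #|nbr (fun x y => [exists i, f (x, i) == y]) A|.
Proof.
move=> pq; pose nf (f : {ffun P * 'I_19 -> Q}) := nbr (fun x y => [exists i, f (x, i) == y]).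
pose bad f := [exists A : {set P}, (4 * #|A| <= 3 * #|Q|) && (#|nf f A| < #|A|)].
pose Bad := [set f | bad f].
have [|/subsetPn[f _ fB]] := boolP ([set: {ffun P * 'I_19 -> Q}] \subset Bad); last first.
  exists f => A hA; move: fB; rewrite inE negb_exists => /forallP/(_ A).
  by rewrite hA /= -leqNgt.
move/subset_leq_card; rewrite leqNgt => /negP[].
rewrite cardsT card_ffun card_prod card_ord mulnC.
have [Q0|Q0] := posnP #|Q|.
  have P0 : #|P| = 0 by lia.
  rewrite P0 muln0 expn0 ltnS leqn0 cards_eq0; apply/eqP/setP => f; rewrite !inE.
  apply/negbTE; rewrite negb_exists; apply/forallP => A.
  by have := max_card (mem A); rewrite P0 leqn0 => /eqP->; rewrite ltn0 andbF.
pose conf (p : {set P} * {set Q}) :=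
  [set f : {ffun P * 'I_19 -> Q} | [forall x in p.1, forall i, f (x, i) \in p.2]].
pose dr a := setX [set A : {set P} | #|A| == a] [set B : {set Q} | #|B| == a].
have sub : Bad \subset \bigcup_(a < #|P|.+1 | (0 < a) && (4 * a <= 3 * #|Q|)) \bigcup_(p in dr a) conf p.
  apply/subsetP => f; rewrite inE => /existsP[A /andP[hA ltA]].
  have AP : #|A| < #|P|.+1 by rewrite ltnS max_card.
  (* The neighbourhood of a bad [A] is padded to exactly [#|A|] elements, so that a single size [a]
     indexes the pairs in the union bound. *)
  have [|B [nB _ cB]] := @exists_superset_card _ #|A| (nf f A) setT (subsetT _).
    by rewrite (ltnW ltA) cardsT; lia.
  apply/bigcupP; exists (Ordinal AP); first by rewrite /= hA andbT (leq_ltn_trans _ ltA).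
  apply/bigcupP; exists (A, B); first by rewrite !inE /= cB !eqxx.
  rewrite inE; apply/forall_inP => x xA; apply/forallP => i; apply: (subsetP nB).
  by apply/nbrP; exists x => //; apply/existsP; exists i.
pose t a := if (0 < a) && (4 * a <= 3 * #|Q|) then
  'C(#|P|, a) * 'C(#|Q|, a) * (a ^ (19 * a) * #|Q| ^ (19 * (#|P| - a))) else 0.
apply: leq_ltn_trans (_ : \sum_(1 <= a < #|P|.+1) t a < _).
  apply: leq_trans (subset_leq_card sub) _; apply: leq_trans (card_bigcup_leq _ _) _.
  rewrite big_mkcond -[X in _ <= X]add0n -[X in X + _]/(t 0) -big_ltn // big_mkord.
  apply: leq_sum => a _; rewrite /t; case: ifP => // _.
  apply: leq_trans (card_bigcup_leq _ _) _.
  under eq_bigr => p; first rewrite inE !inE => /andP[/eqP h1 /eqP h2].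
    rewrite card_confined h1 h2 card_ord.
  over.
  by rewrite sum_nat_const cardsX !card_draws.
apply: geometric_sum_bound; first by rewrite expn_gt0 Q0.
move=> a /andP[a0 aP]; rewrite /t; case: ifP => [/andP[_ h]|_]; last by rewrite muln0.
exact: expander_term.
Qed.
End Expander.

(** * Robust bipartite templates *)

Section Template.
Variables X Y Z : finType.

Definition remaining (X' : {set X}) : {set X + Y} :=
  [set p | if p is inl x then x \in X' else true].

Lemma card_remaining X' : #|remaining X'| = #|X'| + #|Y|.
Proof.
have l z (A : {set X}) : ((inl z : X + Y) \in inl @: A) = (z \in A).
  by rewrite mem_imset //; apply: inl_inj.
have r z (A : {set Y}) : ((inr z : X + Y) \in inr @: A) = (z \in A).
  by rewrite mem_imset //; apply: inr_inj.
have lr z (A : {set X}) : ((inr z : X + Y) \in inl @: A) = false.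
  by apply/imsetP => -[].
have rl z (A : {set Y}) : ((inl z : X + Y) \in inr @: A) = false.
  by apply/imsetP => -[].
rewrite -(card_imset (mem X') (@inl_inj X Y)) -cardsT -(card_imset setT (@inr_inj X Y)).
rewrite -[LHS](cardsID (inl @: X')); congr (_ + _); apply: eq_card => -[x|y].
- by rewrite in_setI !l inE andbb.
- by rewrite in_setI !lr andbF.
- by rewrite in_setD l rl inE andNb.
by rewrite in_setD lr r !inE.
Qed.

(* Montgomery's robustly matchable bipartite graph. *)
Lemma robust_template : 0 < #|X| -> #|Y| = #|X|.*2 -> #|X|.*2 <= #|Z| <= 3 * #|X| ->
  exists2 E : {set (X + Y) * Z}, #|E| <= 114 * #|X| &
    forall X' : {set X}, #|X'| + #|Y| = #|Z| ->
      exists f : X + Y -> Z, [/\ {in remaining X' &, injective f},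
        forall p, p \in remaining X' -> (p, f p) \in E & f @: remaining X' = setT].
Proof.
move=> X0 cY /andP[Z2 Z3].
have [f1 h1] : exists f : {ffun (X + Y) * 'I_19 -> Z}, forall A : {set X + Y},
    4 * #|A| <= 3 * #|Z| -> #|A| <= #|nbr (fun x y => [exists i, f (x, i) == y]) A|.
  by apply: expander_exists; rewrite card_sum; lia.
have [f2 h2] : exists f : {ffun Z * 'I_19 -> Y}, forall A : {set Z},
    4 * #|A| <= 3 * #|Y| -> #|A| <= #|nbr (fun x y => [exists i, f (x, i) == y]) A|.
  by apply: expander_exists; lia.
(* An expander from [X + Y] to [Z] is joined with a reversed expander from [Z] to [Y]. Each vertex
   contributes at most 19 edges to its expander, so there are at most $19(3|X| + |Z|) \le
   114|X|$. *)
pose E : {set (X + Y) * Z} := [set (pi.1, f1 pi) | pi in setT] :|: [set (inr (f2 zi), zi.1) | zi in setT].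
exists E.
  rewrite (leq_trans (leq_card_setU _ _)) //.
  apply: leq_trans (leq_add (leq_imset_card _ _) (leq_imset_card _ _)) _.
  by rewrite !cardsT !card_prod card_sum card_ord; lia.
move=> X' cX'; have cD := card_remaining X'.
have [z0 _] : exists z0 : Z, z0 \in setT by apply/set0Pn; rewrite -card_gt0 cardsT; lia.
pose e p z := (p, z) \in E.
have e1 A : nbr (fun x y => [exists i, f1 (x, i) == y]) A \subset nbr e A.
  apply/subsetP => z /nbrP[p pA /existsP[i /eqP <-]]; apply/nbrP; exists p => //.
  by apply/setUP; left; apply/imsetP; exists (p, i).
have [A AD|f [fi fe]] := @hall _ _ z0 e (remaining X').
  (* Hall's condition for a small [A] comes from [f1]. A large [A] misses only a set [S] of about a
     quarter of [Z]; under [f2], [S] has at least $|S|$ neighbours, none of them in [A], so $|S| \le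
     |Z| - |A|$. *)
  have [sA|lA] := leqP (4 * #|A|) (3 * #|Z|).
    by rewrite (leq_trans (h1 _ sA)) // subset_leq_card.
  have [|A0 A0A cA0] := @exists_subset_card _ ((3 * #|Z|) %/ 4) A.
    by move: #|A| #|Z| lA => *; lia.
  have lN : (3 * #|Z|) %/ 4 <= #|nbr e A|.
    rewrite -cA0 (leq_trans (h1 A0 _)) //; first by rewrite cA0; lia.
    by rewrite subset_leq_card // (subset_trans (e1 A0)) // nbrS.
  have := cardsC (nbr e A); set S := ~: nbr e A => cS.
  have := h2 S; set NS := nbr _ S => /(_ ltac:(lia)) lS.
  have sub : inr @: NS \subset remaining X' :\: A.
    apply/subsetP => _ /imsetP[y /nbrP[z zS /existsP[i /eqP <-]] ->].
    rewrite !inE andbT; apply: contraL zS => yA; rewrite inE negbK; apply/nbrP.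
    by exists (inr (f2 (z, i))) => //; apply/setUP; right; apply/imsetP; exists (z, i).
  have := subset_leq_card sub; rewrite card_imset ?cardsDS //; last exact: inr_inj.
  have := subset_leq_card AD; rewrite cD cX' => lAZ lNS.
  rewrite -(leq_add2r #|S|) cS -(subnKC lAZ) leq_add2l.
  exact: leq_trans lS lNS.
exists f; split=> //; apply/eqP; rewrite eqEcard subsetT cardsT card_in_imset //.
by rewrite cD cX' leqnn.
Qed.

End Template.

(** * The lattice of spikes and fans *)

Section IntegerReduction.
Variables (I : finType) (f : I -> I) (k : nat).
Hypothesis k3 : 3 <= k.

(* [spike i] and [fan i] count, class by class, the vertices of a clique with one vertex in
   [f i] and [k - 1] in [i], resp. with one vertex in [i] and [k - 1] in [f i]. *)
Definition spike (i l : I) : nat := k.-1 * (l == i) + (l == f i).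
Definition fan (i l : I) : nat := (l == i) + k.-1 * (l == f i).

Lemma spike_fan i l : k.-1 * spike i l = fan i l + k * (k - 2) * (l == i).
Proof. rewrite /spike /fan; case: (l == i); case: (l == f i); nia. Qed.

Local Open Scope ring_scope.
Import GRing.Theory Num.Theory.

Lemma sum_delta (i : I) (F : I -> int) : \sum_j (j == i)%:R * F j = F i.
Proof.
rewrite (bigD1 i) //= eqxx mul1r big1 ?addr0 // => j /negbTE->; exact: mul0r.
Qed.

(* While some [v i] is at least [k], either subtract a spike at [i], or, if [v (f i)] vanishes,
   replace a spike by a fan; both decrease the sum of the squares of [v]. *)
Lemma reduce_small (v : I -> nat) (C : nat) : (\sum_i v i * v i <= C)%N ->
  exists (w : I -> nat) (x y : I -> int),
  [/\ forall l : I, (w l < k)%N,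
      forall i : I, `|x i| <= C%:R /\ `|y i| <= C%:R &
      forall l, (v l)%:R = (w l)%:R + \sum_i (x i * (spike i l)%:R + y i * (fan i l)%:R)].
Proof.
elim: C v => [|C IH] v vC.
  exists v, (fun=> 0), (fun=> 0); split=> [l||l].
  - move: vC; rewrite leqn0 sum_nat_eq0 => /forall_inP/(_ l isT).
    by rewrite muln_eq0 orbb => /eqP->; lia.
  - by move=> i; rewrite normr0.
  by rewrite big1 ?addr0 // => i _; rewrite !mul0r addr0.
have [/forallP small|/forallPn[i]] := boolP [forall i, v i < k]%N.
  exists v, (fun=> 0), (fun=> 0); split=> // l.
  by rewrite big1 ?addr0 // => i _; rewrite !mul0r addr0.
rewrite -leqNgt => ki.
have step (v' : I -> nat) (a b : int) : (\sum_j v' j * v' j < \sum_j v j * v j)%N ->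
    `|a| <= 1 -> `|b| <= 1 ->
    (forall l, (v l)%:R = (v' l)%:R + (a * (spike i l)%:R + b * (fan i l)%:R) :> int) ->
    exists (w : I -> nat) (x y : I -> int),
  [/\ forall l : I, (w l < k)%N,
      forall i : I, `|x i| <= C.+1%:R /\ `|y i| <= C.+1%:R &
      forall l, (v l)%:R = (w l)%:R + \sum_i (x i * (spike i l)%:R + y i * (fan i l)%:R)].
  move=> dec a1 b1 eqv; have [|w [x [y [wk xy eqw]]]] := IH v'; first by lia.
  exists w, (fun j => x j + (j == i)%:R * a), (fun j => y j + (j == i)%:R * b); split=> // [j|l].
    have [hx hy] := xy j; case: (j == i); rewrite ?mul1r ?mul0r; split; lia.
  rewrite eqv eqw -addrA; congr (_ + _).
  rewrite -(sum_delta i (fun j => a * (spike j l)%:R + b * (fan j l)%:R)) -big_split /=.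
  by apply: eq_bigr => j _; ring.
pose v1 (l : I) := (v l - spike i l)%N.
pose v2 l := if l == i then (v i - (k - 2))%N else if l == f i then (k - 2)%N else v l.
(* The first case means $f(i) \ne i$ and $v(f(i)) = 0$. When $f(i) = i$ the spike is $k$ times a
   unit vector and can be subtracted at once. *)
have [fi0|fi0] := posnP (if f i == i then 1%N else v (f i)).
  apply: (step v2 1 (-1)) => // [|l].
    have fii : f i != i by move: fi0; case: eqP.
    rewrite (negbTE fii) in fi0.
    rewrite (bigD1 i) //= [X in (_ < X)%N](bigD1 i) //=.
    rewrite (bigD1 (f i)) //= [X in (_ < _ + X)%N](bigD1 (f i)) //=.
    rewrite /v2 eqxx (negbTE fii) eqxx fi0.
    under eq_bigr => j /andP[/negbTE-> /negbTE->] do [].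
    by move: (\sum_(j | _) _)%N => S; nia.
  move: fi0; rewrite /v2 /spike /fan; case: (eqVneq (f i) i) => [//|fii fi0].
  case: (eqVneq l i) => [->|li]; first by rewrite eq_sym (negbTE fii); lia.
  by case: (eqVneq l (f i)) => [->|_]; rewrite ?fi0; lia.
have sp l : (spike i l <= v l)%N.
  rewrite /spike; case: (eqVneq l i) => [->|li].
    by move: fi0; rewrite eq_sym; case: eqVneq; lia.
  case: (eqVneq l (f i)) => [e|]; last by lia.
  by move: fi0; rewrite -e (negbTE li); lia.
apply: (step v1 1 0) => // [|l]; last by have := sp l; rewrite /v1; lia.
rewrite (bigD1 i) //= [X in (_ < X)%N](bigD1 i) //= -addSn leq_add //.
  by have := sp i; rewrite /v1 /spike eqxx; nia.
by apply: leq_sum => l _; rewrite /v1 leq_mul ?leq_subr.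
Qed.

(* By [spike_fan], [k * (k - 2)] times a unit vector lies in the lattice of spikes and fans, so
   that [- d] is congruent to a vector with small nonnegative entries. *)
Lemma balance (d : I -> nat) (B S : nat) : (forall l, d l <= B)%N ->
  (#|I| * (k * (k - 2)) ^ 2 + B.+1 * k <= S)%N ->
  exists E a b : I -> nat, [/\ forall l, (E l < k)%N,
    forall i, (a i <= S.*2)%N /\ (b i <= S.*2)%N &
    forall l, (d l + \sum_i (a i * spike i l + b i * fan i l) + E l
               = \sum_i (S * spike i l + S * fan i l))%N].
Proof.
move=> dB; set M := (k * (k - 2))%N => hS.
have M0 : (0 < M)%N by rewrite muln_gt0; lia.
(* [r] completes [d] to a multiple of [M]. Its entries are at most [M] whatever [B] is, so
   [reduce_small] yields coefficients bounded by $|I|M^2$. *)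
pose q l := (d l %/ M).+1; pose r l := (q l * M - d l)%N.
have rM l : (d l + r l = q l * M)%N /\ (r l <= M)%N.
  by rewrite /r /q; have := divn_eq (d l) M; have := ltn_pmod (d l) M0; lia.
have [|w [x [y [wk xy eqr]]]] := @reduce_small r (#|I| * M ^ 2).
  rewrite -sum_nat_const; apply: leq_sum => i _.
  by have [_ h] := rM i; rewrite -mulnn leq_mul.
have qB l : (q l <= B.+1)%N by rewrite /q ltnS (leq_trans _ (dB l)) ?leq_div.
(* By [spike_fan], $q_iM$ times a unit vector is $q_i(k-1)$ spikes minus $q_i$ fans. Hence, without
   the shift by [S], these coefficients represent $-(d+w)$; the shift brings them between 0 and
   $2S$. *)
clearbody q; pose a i := S%:R + x i - (q i * k.-1)%:R; pose b i := S%:R + y i + (q i)%:R.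
have ab i : 0 <= a i <= S.*2%:R /\ 0 <= b i <= S.*2%:R.
  have [xi yi] := xy i; have qi := qB i; rewrite /a /b.
  have : (q i * k.-1 <= B.+1 * k)%N by rewrite leq_mul ?leq_pred.
  have : (q i <= B.+1 * k)%N by nia.
  move: (q i * k.-1)%N (B.+1 * k)%N (#|I| * M ^ 2)%N xi yi hS => u v c; lia.
exists w, (fun i => `|a i|%N), (fun i => `|b i|%N); split=> // [i|l].
  by have := ab i; lia.
apply/eqP; rewrite -(eqr_nat int) !natrD !natr_sum; apply/eqP.
have eq1 : (d l)%:R + (r l)%:R = \sum_i ((q i * k.-1)%:R * (spike i l)%:R - (q i)%:R * (fan i l)%:R) :> int.
  rewrite -natrD (rM l).1.
  rewrite -(sum_delta l (fun i => (q i * M)%:R)); apply: eq_bigr => i _.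
  have := spike_fan i l; rewrite [l == i]eq_sym -/M => /(congr1 (fun n : nat => n%:R : int)).
  rewrite natrD !natrM => e.
  by rewrite -[_ * _ * (spike i l)%:R]mulrA e; ring.
rewrite eqr in eq1.
have -> : (d l)%:R = \sum_i ((q i * k.-1)%:R * (spike i l)%:R - (q i)%:R * (fan i l)%:R)
  - (w l)%:R - \sum_i (x i * (spike i l)%:R + y i * (fan i l)%:R) :> int by rewrite -eq1; ring.
set S1 := \sum_i (_ - _); set S2 := \sum_i (x i * _ + _).
set S3 := \sum_i _; set S4 := \sum_i _.
suff -> : S3 = S4 + S2 - S1 by ring.
rewrite /S1 /S2 /S3 /S4 -big_split -sumrB /=; apply: eq_bigr => i _.
have [/andP[a0 _] /andP[b0 _]] := ab i.
move: (spike i l) (fan i l) => p p'; rewrite !natrD !natrM.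
have -> : (`|a i|%N)%:R = a i by rewrite natz gez0_abs.
have -> : (`|b i|%N)%:R = b i by rewrite natz gez0_abs.
by rewrite /a /b natrM; ring.
Qed.
End IntegerReduction.

(** * Tilings by cliques *)

Lemma cards_disjU (T : finType) (A B : {set T}) :
  [disjoint A & B] -> #|A :|: B| = #|A| + #|B|.
Proof. by move=> dAB; rewrite cardsU disjoint_setI0 // cards0 subn0. Qed.

(** Quantification over a boolean as a computation; nested once per membership atom, it is the truth
    table that [set_tac] evaluates. *)
Definition allb (f : bool -> bool) := if f true then f false else false.

Lemma allbP (f : bool -> bool) : allb f -> forall b, f b.
Proof. by rewrite /allb; case ft: (f true) => // ff []. Qed.

Lemma disjoint_at (T : finType) (x : T) (A B : {pred T}) :
  [disjoint A & B] -> ~~ ((x \in A) && (x \in B)).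
Proof. by move/pred0P/(_ x) => /= ->. Qed.

Lemma disjoint_from_at (T : finType) (A B : {pred T}) :
  (forall x, ~~ ((x \in A) && (x \in B))) -> [disjoint A & B].
Proof. by move=> h; apply/pred0P => x /=; apply/negbTE. Qed.

Lemma subset_at (T : finType) (x : T) (A B : {pred T}) :
  A \subset B -> (x \in A) ==> (x \in B).
Proof. by move/subsetP/(_ x)/implyP. Qed.

Lemma subset_from_at (T : finType) (A B : {pred T}) :
  (forall x, (x \in A) ==> (x \in B)) -> A \subset B.
Proof. by move=> h; apply/subsetP => x; apply/implyP. Qed.

Lemma eqset_from_at (T : finType) (A B : {set T}) :
  (forall x, eqb (x \in A) (x \in B)) -> A = B.
Proof. by move=> h; apply/setP => x; apply/eqP/h. Qed.

(* Decides a pointwise statement about sets from the inclusions, disjointness and memberships in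
   the context, by running through the truth values of the memberships of one point. *)
Ltac set_atoms :=
  lazymatch goal with
  | |- context [?x == ?x] => rewrite (eqxx x); set_atoms
  | H : is_true (?x != ?y) |- context [?x == ?y] => rewrite (negbTE H); set_atoms
  | H : is_true (?x != ?y) |- context [?y == ?x] => rewrite [y == x]eq_sym (negbTE H); set_atoms
  | |- context [@eq_op ?T ?x ?y] =>
      case: (@eqVneq T x y) => [->|?]; rewrite ?eqxx; set_atoms
  | |- context [@in_mem ?T ?x ?A] =>
      let b := fresh "b" in
      generalize (@in_mem T x A); intro b; set_atoms; revert b; refine (@allbP _ _)
  | |- _ => idtac
  end.

Ltac set_facts x :=
  repeat match goal with
  | H : is_true [disjoint _ & _] |- _ => move/(disjoint_at x): H; apply/implyP
  | H : is_true (_ \subset _) |- _ => move/(subset_at x): H; apply/implyP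
  | H : is_true (_ \in _) |- _ => move: H; apply/implyP
  | H : is_true (_ \notin _) |- _ => move: H; apply/implyP
  end;
  rewrite ?(in_setU, in_setI, in_setD, in_setC, in_set1, in_set0, in_setT).

Ltac set_tac :=
  let x := fresh "x" in
  lazymatch goal with
  | |- is_true [disjoint _ & _] => apply: disjoint_from_at; intro x; set_facts x
  | |- is_true (_ \subset _) => apply: subset_from_at; intro x; set_facts x
  | |- is_true (?y \in _) => set_facts y
  | |- is_true (?y \notin _) => set_facts y
  | |- @eq _ _ _ => apply: eqset_from_at; intro x; set_facts x
  end; set_atoms; vm_compute; reflexivity.

(** Bernoulli's inequality $(c+1)^t \ge c^t + tc^{t-1}$ with $t = mc$. *)
Lemma exists_expn_ratio m c : 0 < c -> exists t, m * c ^ t <= c.+1 ^ t.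
Proof.
move=> c0; exists (m * c); have h t : c ^ t + t * c ^ t.-1 <= c.+1 ^ t.
  elim: t => [|[|t] IH] //; first by rewrite !expn1 expn0 muln1; lia.
  rewrite [c.+1 ^ _]expnS !expnS in IH *; rewrite /= in IH *.
  by move: (c ^ t) (c.+1 ^ t) IH => x y; nia.
have := h (m * c); case emc: (m * c) => [|t] /=.
  by move/eqP: emc; rewrite muln_eq0; case: m => [|m] /=; lia.
by rewrite -emc mulnAC -mulnA -expnSr emc; lia.
Qed.

Section Tilings.
Variables (T : finType) (e : rel T) (k : nat).
Hypotheses (esym : symmetric e) (eirr : irreflexive e) (k3 : 3 <= k).

Definition neigh (x : T) : {set T} := [set y | e x y].

Definition clique (A : {set T}) := [forall x in A, forall y in A, (x != y) ==> e x y].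

Definition tile (A : {set T}) := (#|A| == k) && clique A.

(** Only the covered vertex set of a tiling is recorded; the copies themselves are recovered in
    [tileable_tiling]. *)
Inductive tileable : {set T} -> Prop :=
| tileable_set0 : tileable set0
| tileable_add (A B : {set T}) : tile A -> [disjoint A & (B : {set T})] -> tileable B -> tileable (A :|: B).

Lemma cliqueP (A : {set T}) :
  reflect {in A &, forall x y, x != y -> e x y} (clique A).
Proof.
apply: (iffP forall_inP) => h x; last by move=> xA; apply/forall_inP => y yA; apply/implyP; apply: h.
by move=> y xA yA; have /forall_inP/(_ y yA)/implyP := h x xA.
Qed.

Lemma tile_neigh x (A : {set T}) : clique A -> #|A| = k.-1 -> A \subset neigh x -> tile (x |: A).
Proof.
move=> /cliqueP cA nA /subsetP AN.
have xA : x \notin A by apply/negP => /AN; rewrite inE eirr.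
rewrite /tile cardsU1 xA nA (_ : (_ == k)); last by apply/eqP; move: k3 => /=; lia.
apply/cliqueP => u v; rewrite !in_setU1 => /predU1P[->|uA] /predU1P[->|vA]; rewrite ?eqxx //.
- by move=> _; have := AN _ vA; rewrite inE.
- by move=> _; have := AN _ uA; rewrite inE esym.
exact: cA.
Qed.

Lemma tileable1 A : tile A -> tileable A.
Proof. by move=> tA; rewrite -[A]setU0; apply: tileable_add tileable_set0; rewrite // ; set_tac. Qed.

Lemma tileable_setU A B : tileable A -> tileable B -> [disjoint A & B] -> tileable (A :|: B).
Proof.
move=> tA tB; elim: tA => [|C D tC dCD tD IH] dB; first by rewrite set0U.
rewrite -setUA; apply: tileable_add; rewrite //; first by set_tac.
by apply: IH; set_tac.
Qed.

Lemma tileable_bigcup (I : finType) (P : pred I) (F : I -> {set T}) :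
    (forall i, P i -> tileable (F i)) ->
    (forall i j, P i -> P j -> i != j -> [disjoint F i & F j]) ->
  tileable (\bigcup_(i | P i) F i).
Proof.
move=> tF dF; rewrite -big_filter; have := filter_uniq P (index_enum_uniq I).
have : {subset [seq i <- index_enum I | P i] <= P} by move=> i; rewrite mem_filter => /andP[].
elim: [seq _ <- _ | _] => [|i s IH] sP /=; first by rewrite big_nil => _; apply: tileable_set0.
move=> /andP[is_ us]; have Pi : P i by apply: sP; rewrite mem_head.
rewrite big_cons; apply: tileable_setU; first exact: tF.
  by apply: IH us => j js; apply: sP; rewrite in_cons js orbT.
clear IH us; elim: s sP is_ => [|j s IH] sP; first by rewrite big_nil => _; set_tac.
rewrite in_cons negb_or big_cons => /andP[ij js].
have dij : [disjoint F i & F j] by apply: dF => //; apply: sP; rewrite !in_cons eqxx orbT.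
have dis : [disjoint F i & \bigcup_(j <- s) F j].
  by apply: IH js => l; rewrite in_cons => /predU1P[->|ls] //; apply: sP; rewrite !in_cons ls !orbT.
set_tac.
Qed.

Lemma sum_setU (w : T -> nat) (A B : {set T}) : [disjoint A & B] ->
  \sum_(x in A :|: B) w x = \sum_(x in A) w x + \sum_(x in B) w x.
Proof. by move=> dAB; rewrite -bigU //; apply: eq_bigl => x; rewrite !inE. Qed.

(** Averaging: [U] splits into $|U|/k$ tiles, so some tile weighs more than $c$. The remaining tiles
    are returned as [B], for use in exchange steps. *)
Lemma heavy_tile (w : T -> nat) (c : nat) U : tileable U ->
  c * #|U| < k * \sum_(x in U) w x ->
  exists A B : {set T}, [/\ tile A, tileable B, [disjoint A & B], U = A :|: B & c < \sum_(x in A) w x].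
Proof.
elim=> [|A B tA dAB tB IH]; first by rewrite big_set0 cards0 !muln0.
rewrite cards_disjU // sum_setU //.
have /andP[/eqP cA _] := tA; rewrite cA => lt.
have [h|h] := ltnP c (\sum_(x in A) w x); first by exists A, B.
have [|C [D [tC tD dCD eB hC]]] := IH; first by nia.
exists C, (A :|: D); split=> //; first by apply: tileable_add => //; rewrite eB in dAB; set_tac.
  by rewrite eB in dAB; set_tac.
by rewrite eB; set_tac.
Qed.

Lemma double_count (A B : {set T}) :
  \sum_(x in A) #|neigh x :&: B| = \sum_(y in B) #|neigh y :&: A|.
Proof.
under eq_bigr => x _ do rewrite -sum1_card.
under [RHS]eq_bigr => x _ do rewrite -sum1_card.
rewrite (exchange_big_dep (mem B)) /=; last by move=> x y _; rewrite in_setI => /andP[].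
apply: eq_bigr => y yB; apply: eq_bigl => x.
by rewrite !in_setI yB andbT andbC; congr (_ && _); rewrite !inE esym.
Qed.

(** By double counting, at least $n/4k$ vertices are adjacent to a $1/4k$ fraction of [B]. Taking
    $8k\rho$ of them as [P] gives at least $2\rho|B|$ edges between [P] and [B], so at least
    $|B|/8k$ vertices of [B] have $\rho$ neighbours in [P]. *)
Lemma reservoir_step rho (B : {set T}) : (forall x, #|T| <= k * #|neigh x|) ->
    32 * k ^ 2 * rho <= #|T| ->
  exists P : {set T}, #|P| <= 8 * k * rho /\
    8 * k * #|[set u in B | #|neigh u :&: P| < rho]| <= (8 * k).-1 * #|B|.
Proof.
move=> deg hrho.
have [->|Bn0] := eqVneq B set0.
  exists set0; rewrite cards0 muln0; split=> //.
  by rewrite (_ : [set _ in _ | _] = set0) ?cards0 ?muln0 //; apply/setP => u; rewrite !inE.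
have [->|rho0] := posnP rho.
  exists set0; rewrite cards0; split=> //.
  by rewrite (_ : [set _ in _ | _] = set0) ?cards0 ?muln0 //; apply/setP => u; rewrite !inE ltn0 andbF.
have B0 : 0 < #|B| by rewrite card_gt0.
pose H := [set x | #|B| <= 4 * k * #|neigh x :&: B|].
have bigH : #|T| <= 4 * k * #|H|.
  have dc := double_count setT B.
  have l1 : #|T| * #|B| <= k * \sum_(y in B) #|neigh y :&: setT|.
    by rewrite mulnC -sum_nat_const big_distrr leq_sum // => y _; rewrite setIT.
  have l2 : 4 * k * \sum_(x in setT) #|neigh x :&: B| <= 4 * k * #|H| * #|B| + #|T| * #|B|.
    rewrite (bigID (mem H)) /= mulnDr leq_add //.
      rewrite -!mulnA leq_mul2l leq_mul2l -sum_nat_const; apply/orP; right; apply/orP; right.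
      rewrite (eq_bigl (mem H)) => [|x]; last by rewrite inE.
      by apply: leq_sum => x _; rewrite subset_leq_card // subsetIr.
    rewrite big_distrr /= -cardsT -sum_nat_const big_mkcondr /=.
    by apply: leq_sum => x _; case: ifP => //; rewrite inE -ltnNge => /ltnW.
  rewrite dc in l2; rewrite -(leq_pmul2r B0).
  move: (\sum_(y in B) _) (#|T| * #|B|) l1 l2 => s q l1 l2; lia.
have [|P PH cP] := @exists_subset_card T (8 * k * rho) H.
  by rewrite -(leq_pmul2l (_ : 0 < 4 * k)); lia.
exists P; split; first by rewrite cP.
pose G := [set u in B | rho <= #|neigh u :&: P|].
have bigG : #|B| <= 8 * k * #|G|.
  have l1 : 2 * rho * #|B| <= \sum_(u in B) #|neigh u :&: P|.
    rewrite -(leq_pmul2l (_ : 0 < 4 * k)); last by lia.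
    rewrite -double_count big_distrr /=.
    apply: leq_trans (_ : \sum_(x in P) #|B| <= _).
      by rewrite sum_nat_const cP; lia.
    by apply: leq_sum => x /(subsetP PH); rewrite inE.
  have l2 : \sum_(u in B) #|neigh u :&: P| <= 8 * k * #|G| * rho + #|B| * rho.
    rewrite (bigID (mem G)) /= leq_add //.
      rewrite mulnAC -cP mulnC -sum_nat_const.
      rewrite (eq_bigl (mem G)) => [|x]; last by rewrite !inE; case: (x \in B).
      by apply: leq_sum => x _; rewrite subset_leq_card // subsetIr.
    rewrite -sum_nat_const big_mkcondr /=; apply: leq_sum => x xB.
    by case: ifP => //; rewrite inE xB /= -ltnNge => /ltnW.
  by rewrite -(leq_pmul2r rho0); lia.
have := cardsID G B; rewrite (_ : B :&: G = G); last first.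
  by apply/setP => x; rewrite !inE; case: (x \in B).
rewrite (_ : B :\: G = [set u in B | #|neigh u :&: P| < rho]); last first.
  by apply/setP => x; rewrite in_setD !inE; case: (x \in B); rewrite //= ?andbF // andbT -ltnNge.
by nia.
Qed.

(** Iterating [reservoir_step] shrinks the set of vertices with too few neighbours in [X] by a
    factor $1 - 1/8k$ each time. The reservoir is later used by [cover_greedy] to cover leftover
    vertices. *)
Lemma reservoir rho t : (forall x, #|T| <= k * #|neigh x|) -> 32 * k ^ 2 * rho <= #|T| ->
  exists X : {set T}, #|X| <= t * (8 * k * rho) /\
    (8 * k) ^ t * #|[set u | #|neigh u :&: X| < rho]| <= (8 * k).-1 ^ t * #|T|.
Proof.
move=> deg hrho; elim: t => [|t [X [cX hX]]].
  by exists set0; rewrite cards0 !expn0 !mul1n max_card.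
have [P [cP hP]] := reservoir_step [set u | #|neigh u :&: X| < rho] deg hrho.
exists (X :|: P); split; first by rewrite (leq_trans (leq_card_setU _ _)) // mulSn addnC leq_add.
set B := [set u | _] in hX hP; set B' := [set u in B | _] in hP; set B'' := [set u | _].
have sub : #|B''| <= #|B'|.
  apply/subset_leq_card/subsetP => u; rewrite !inE setIUr => h.
  apply/andP; split; apply: leq_ltn_trans h; apply: subset_leq_card.
    exact: subsetUl.
  exact: subsetUr.
rewrite !expnS; move: ((8 * k) ^ t) ((8 * k).-1 ^ t) hX => x y hX.
apply: leq_trans (_ : x * (8 * k * #|B'|) <= _).
  by rewrite -mulnA mulnCA leq_mul2l leq_mul2l sub !orbT.
apply: leq_trans (_ : x * ((8 * k).-1 * #|B|) <= _); first by rewrite leq_mul2l hP orbT.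
by rewrite mulnCA -mulnA leq_mul2l hX orbT.
Qed.

(** * Almost perfect tilings and greedy covers *)

Section Rich.
Variable a : nat.
Hypothesis rich : forall U : {set T}, a < #|U| ->
  exists A : {set T}, [/\ A \subset U, #|A| = k.-1 & clique A].

(** The surplus in $kD \ge (1+1/g)n$ is worth $ln/g$ after multiplication by $l$; one half pays for
    replacing $D$ by $D-a$, the other for the term $k(a+k)n$. *)
Lemma almost_tiling_arith n l D g : g.+1 * n <= k * g * D -> 2 * k * g * a <= n ->
  2 * k * g * (a + k) < l -> 0 < n ->
  g * ((l + k * (a + k)) * n) < g * (k * (l * (D - a))).
Proof.
set b := a + k; move=> h1 h2 h3 n0.
have aD : a <= D by rewrite leqNgt; apply/negP => h; nia.
rewrite -(subnK aD) in h1; move: (D - a) h1 => d h1.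
have -> : g * (k * (l * d)) = l * (k * g * d) by ring.
have h4 : l * (2 * (g.+1 * n)) <= l * (2 * (k * g * d) + n).
  by rewrite leq_mul2l; apply/orP; right; move: h1; rewrite mulnDr; lia.
have h5 : 2 * k * g * b * n < l * n by rewrite ltn_pmul2r.
rewrite -(ltn_pmul2l (isT : 0 < 2)).
have -> : 2 * (g * ((l + k * b) * n)) = 2 * g * l * n + 2 * k * g * b * n by ring.
move: (k * g * d) (2 * k * g * b * n) h4 h5 => p q h4 h5; nia.
Qed.

Lemma almost_tiling (W : {set T}) (D g : nat) :
    (forall x, x \in W -> D <= #|neigh x :&: W|) ->
    g.+1 * #|T| <= k * g * D -> 2 * k * g * a <= #|T| ->
  exists U : {set T}, [/\ U \subset W, tileable U & #|W :\: U| <= 2 * k * g * (a + k)].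
Proof.
move=> hD hg ha.
have step (U : {set T}) : U \subset W -> tileable U -> 2 * k * g * (a + k) < #|W :\: U| ->
    exists U' : {set T}, [/\ U' \subset W, tileable U' & #|U| < #|U'|].
  move=> UW tU; set L := W :\: U => bigL.
  have [/exists_inP[v vL lt]|/exists_inPn sparse] :=
      boolP [exists v in L, a < #|neigh v :&: L|].
    have [A [AU cA clA]] := rich lt.
    have [AN AL] : A \subset neigh v /\ A \subset L by split; set_tac.
    have /andP[/eqP cvA _] := tile_neigh clA cA AN.
    have AL' : v |: A \subset L by set_tac.
    have [d vW] : [disjoint v |: A & U] /\ v |: A \subset W.
      by rewrite /L in AL'; split; set_tac.
    exists ((v |: A) :|: U); split; first by set_tac.
      exact: tileable_add (tile_neigh clA cA AN) _ _.
    by rewrite cards_disjU // cvA; move: k3 #|U| => + b; clear; lia.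
  pose w x := #|neigh x :&: L|.
  have dbl : \sum_(x in U) w x = \sum_(v in L) #|neigh v :&: U| by apply: double_count.
  have lb : #|L| * (D - a) <= \sum_(x in U) w x.
    rewrite dbl -sum_nat_const; apply: leq_sum => v vL.
    have := sparse v vL; rewrite -leqNgt => sp.
    have vW : v \in W by rewrite /L in vL; set_tac.
    have := hD v vW; rewrite -(cardsID L (neigh v :&: W)).
    have -> : neigh v :&: W :\: L = neigh v :&: U by rewrite /L; set_tac.
    have -> : neigh v :&: W :&: L = neigh v :&: L by rewrite /L; set_tac.
    by lia.
  (* A tile above this threshold has a second vertex with more than $a+k$ neighbours in [L], since
     one vertex contributes at most [#|L|]. *)
  have [|A [B [tA tB dAB eU hA]]] := @heavy_tile w (#|L| + k.-1 * (a + k)) U tU.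
    have Un : #|U| <= #|T| by apply: max_card.
    have Ln : #|L| <= #|T| by apply: max_card.
    have hk : k.-1 <= k by rewrite leq_pred.
    have n0 : 0 < #|T| by apply: leq_trans Ln; lia.
    have g0 : 0 < g by nia.
    rewrite -(ltn_pmul2l g0).
    apply: leq_ltn_trans (_ : g * ((#|L| + k * (a + k)) * #|T|) < _).
      by rewrite leq_mul // leq_mul // leq_add2l leq_mul.
    apply: leq_trans (almost_tiling_arith hg ha bigL n0) _.
    by rewrite leq_mul2l leq_mul2l lb !orbT.
  have /andP[/eqP cA clA] := tA.
  have [x xA xmax] : exists2 x, x \in A & forall y, y \in A -> w y <= w x.
    have [x0 x0A] : exists x0, x0 \in A by apply/set0Pn; rewrite -card_gt0; lia.
    by case: (arg_maxnP w x0A) => x xA hx; exists x.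
  have [y yA wy] : exists2 y, y \in A :\ x & a + k < w y.
    apply/exists_inP; apply: contraLR hA; rewrite negb_exists_in => /forall_inP hw.
    rewrite -leqNgt (big_setD1 x) //= leq_add ?subset_leq_card ?subsetIr //.
    have -> : k.-1 = #|A :\ x| by rewrite -cA (cardsD1 x A) xA.
    by rewrite -sum_nat_const leq_sum // => y yA; rewrite leqNgt hw.
  (* The clique at [y] is chosen first; [x], having the largest weight, keeps more than [a]
     neighbours in [L] outside it. *)
  have [|Ty [TyN cTy clTy]] := rich (U := neigh y :&: L); first by rewrite -/(w y); lia.
  have [|Tx [TxN cTx clTx]] := rich (U := (neigh x :&: L) :\: Ty).
    rewrite cardsD; have := subset_leq_card (subsetIr (neigh x :&: L) Ty).
    have yA' : y \in A by set_tac.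
    have := xmax y yA'; move: wy; rewrite /w cTy; clear; lia.
  have [TxNx TxL dTxy] : [/\ Tx \subset neigh x, Tx \subset L & [disjoint Tx & Ty]].
    by split; set_tac.
  have [TyNy TyL] : Ty \subset neigh y /\ Ty \subset L by split; set_tac.
  have tx := tile_neigh clTx cTx TxNx; have ty := tile_neigh clTy cTy TyNy.
  have [/eqP cx _] := andP tx; have [/eqP cy _] := andP ty.
  rewrite /L eU in TxL TyL UW.
  have d1 : [disjoint y |: Ty & B] by set_tac.
  have d2 : [disjoint x |: Tx & (y |: Ty) :|: B] by set_tac.
  exists ((x |: Tx) :|: ((y |: Ty) :|: B)); split; first by set_tac.
    by do 2![apply: tileable_add => //].
  rewrite eU (cards_disjU d2) (cards_disjU d1) (cards_disjU dAB) cx cy cA.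
  by move: k3 #|B| => + b; clear; lia.
(* [step] can be iterated only finitely often, since [#|U|] grows and is at most [#|T|]. *)
have ex m (U : {set T}) : #|T| - #|U| <= m -> U \subset W -> tileable U ->
  exists U : {set T}, [/\ U \subset W, tileable U & #|W :\: U| <= 2 * k * g * (a + k)].
  elim: m U => [|m IH] U hm UW tU; have [small|big] := leqP #|W :\: U| (2 * k * g * (a + k)); try by exists U.
    have [U' [_ _ lt]] := step U UW tU big; have mU : #|U'| <= #|T| := max_card _; clear -hm lt mU; lia.
  have [U' [U'W tU' lt]] := step U UW tU big; apply: (IH U') => //.
  by have mU : #|U'| <= #|T| := max_card _; clear -hm lt mU; lia.
exact: (ex _ set0 (leqnn _) (sub0set _) tileable_set0).
Qed.

(** Each vertex of [B] is completed to a tile by a clique in [P]; at most $m(k-1)$ vertices of [P]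
    are spent, which the degree condition allows for. *)
Lemma cover_greedy m (B P : {set T}) : #|B| <= m -> [disjoint B & P] ->
    (forall u, u \in B -> a + m * k.-1 < #|neigh u :&: P|) ->
  exists S : {set T}, [/\ S \subset P, #|S| <= m * k.-1 & tileable (B :|: S)].
Proof.
elim: m B P => [|m IH] B P Bm dBP hB.
  exists set0; rewrite sub0set cards0 setU0; split=> //.
  by move: Bm; rewrite leqn0 cards_eq0 => /eqP->; apply: tileable_set0.
have [->|[u uB]] := set_0Vmem B.
  by exists set0; rewrite sub0set cards0 setU0; split=> //; apply: tileable_set0.
have [|A [ANP cA clA]] := rich (U := neigh u :&: P); first exact: leq_ltn_trans (leq_addr _ _) (hB u uB).
have [AN AP] : A \subset neigh u /\ A \subset P by split; set_tac.
have tA := tile_neigh clA cA AN.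
have [|||S [SP cS tS]] := IH (B :\ u) (P :\: A).
- by have := cardsD1 u B; rewrite uB; lia.
- by set_tac.
- move=> v; rewrite in_setD1 => /andP[_ vB]; have := hB v vB.
  rewrite -(cardsID A (neigh v :&: P)) setIDA mulSn.
  by have := subset_leq_card (subsetIr (neigh v :&: P) A); rewrite cA; clear; lia.
exists (A :|: S); split; first by set_tac.
  by rewrite (leq_trans (leq_card_setU _ _)) // mulSn cA leq_add2l.
have -> : B :|: (A :|: S) = (u |: A) :|: (B :\ u :|: S) by set_tac.
apply: tileable_add => //.
have uS : u \notin S by set_tac.
set_tac.
Qed.

End Rich.
End Tilings.

(** * Classes of exchangeable vertices *)

Section Links.
Variables (T : finType) (e : rel T) (b : nat).
Local Notation neigh := (neigh e).

(** Reachability as in the lattice-based absorption method: level [r] allows chains of up to $2^r$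
    common-neighbour steps, with at least [b] choices for every intermediate vertex. *)
Fixpoint link (r : nat) (u v : T) : bool :=
  if r is r'.+1 then link r' u v || (b <= #|[set w | link r' u w && link r' w v]|)
  else b <= #|neigh u :&: neigh v|.

Lemma link_sym r : symmetric (link r).
Proof.
elim: r => [|r IH] u v /=; first by rewrite setIC.
rewrite IH; congr (_ || (_ <= _)); apply: eq_card => w.
by rewrite !inE andbC IH [link r u w]IH.
Qed.

Lemma link_mono r r' u v : r <= r' -> link r u v -> link r' u v.
Proof.
move=> /subnK <-; elim: (r' - r) => [//|i IH] h; by rewrite addSn /= IH.
Qed.

Lemma link_trans r u v (W : {set T}) : b <= #|W| ->
  (forall w, w \in W -> link r u w /\ link r w v) -> link r.+1 u v.
Proof.
move=> bW hW /=; rewrite (leq_trans bW) ?orbT // subset_leq_card //.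
by apply/subsetP => w /hW[h1 h2]; rewrite inE h1.
Qed.

(* A set of [c] vertices that are pairwise not linked at level [q.+1 - c], with [c] maximal:
   any [c + 1] vertices contain a pair linked at the next lower level, so every vertex is linked
   to a member of the set, and two vertices linked to the same member only are linked. *)
Lemma link_partition q h : 0 < #|T| ->
    (forall S : {set T}, #|S| = q.+1 ->
      exists x y, [/\ x \in S, y \in S, x != y & link 0 x y]) ->
    (forall x, link 0 x x) -> (forall x, h <= #|[set y | link 0 x y]|) ->
    q * q * b + q * b + b <= h ->
  exists (S : {set T}) (cls : T -> T), [/\ #|S| <= q, forall x, cls x \in S,
    forall x y, cls x = cls y -> link q.+1 x y &
    forall s, s \in S -> b <= #|[set x | cls x == s]|].
Proof.
move=> T0 indep refl0 hdeg hqb.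
have [x0 _] : exists x0 : T, x0 \in setT by apply/set0Pn; rewrite -card_gt0 cardsT.
have q0 : 0 < q.
  case: (posnP q) => // q0; have [|x [y [/set1P-> /set1P->]]] := indep [set x0].
    by rewrite cards1 q0.
  by rewrite eqxx.
pose spread c := [exists S : {set T}, (#|S| == c) &&
  [forall x in S, forall y in S, (x != y) ==> ~~ link (q.+1 - c) x y]].
have sp1 : (1 <= q) && spread 1.
  rewrite q0; apply/existsP; exists [set x0]; rewrite cards1 eqxx /=.
  by apply/forall_inP => x /set1P->; apply/forall_inP => y /set1P->; rewrite eqxx.
have [c /andP[cq /existsP[S /andP[/eqP cS spS]]] cmax] :=
  @ex_maxnP (fun c => (c <= q) && spread c) q (ex_intro _ 1 sp1) (fun c => @proj1 _ _ \o @andP _ _).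
have c0 : 0 < c by apply: cmax.
pose r := q - c; have rE : q.+1 - c = r.+1 by rewrite /r; lia.
rewrite rE in spS.
have apart x y : x \in S -> y \in S -> x != y -> ~~ link r.+1 x y.
  by move=> xS yS; apply/implyP; apply: (forall_inP (forall_inP spS x xS)).
(* For $c < q$ this is the maximality of $c$; for $c = q$ the level [r] is 0 and the pair comes from
   [indep]. *)
have pair (S' : {set T}) : #|S'| = c.+1 -> exists x y, [/\ x \in S', y \in S', x != y & link r x y].
  move=> cS'; have [ltcq|] := ltnP c q; last first.
    move=> qc; have ecq : c = q by lia.
    rewrite /r ecq subnn; apply: indep; by rewrite cS' ecq.
  have : ~~ spread c.+1.
    by apply/negP => sp; have := cmax c.+1; rewrite ltcq sp => /(_ isT); lia.
  rewrite negb_exists => /forallP/(_ S'); rewrite cS' eqxx subSS -/r /=.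
  rewrite negb_forall_in => /exists_inP[x xS']; rewrite negb_forall_in => /exists_inP[y yS'].
  by rewrite negb_imply negbK => /andP[xy lk]; exists x, y.
have refl x r' : link r' x x := link_mono (leq0n r') (refl0 x).
(* [U s] holds the vertices linked to [s] alone. Members of [S] are not linked at level [r.+1], so
   two of them share at most [b] linked vertices and [U s] stays large. *)
pose U s := [set w | link r w s && [forall s' in S, (s' != s) ==> ~~ link r w s']].
have UP w s : w \in U s -> link r w s /\ (forall s', s' \in S -> s' != s -> ~~ link r w s').
  by rewrite inE => /andP[lk /forall_inP far]; split=> // s' /far /implyP.
pose two s s' := [set w | link r s w && link r w s'].
have few s s' : s \in S -> s' \in S -> s != s' -> #|two s s'| <= b.
  by move=> sS s'S ss'; have := apart _ _ sS s'S ss'; rewrite /= negb_or -ltnNge => /andP[_ /ltnW].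
have cover w : exists2 s, s \in S & link r w s.
  have [wS|wS] := boolP (w \in S); first by exists w.
  have [|x [y [xS yS xy lk]]] := pair (w |: S); first by rewrite cardsU1 wS cS add1n.
  move: xS yS; rewrite !in_setU1 => /predU1P[ex|xS] /predU1P[ey|yS].
  - by rewrite ex ey eqxx in xy.
  - by exists y => //; rewrite -ex.
  - by exists x => //; rewrite link_sym -ey.
  by have := apart x y xS yS xy; rewrite (link_mono (leqnSn r) lk).
have bigU s : s \in S -> b <= #|U s|.
  move=> sS; have sub : [set y | link 0 s y] \subset U s :|: \bigcup_(s' in S :\ s) two s s'.
    apply/subsetP => y; rewrite inE => /(link_mono (leq0n r)) sy; rewrite in_setU.
    have [//|/=] := boolP (y \in U s).
    rewrite inE link_sym sy /= negb_forall_in => /exists_inP[s' s'S].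
    rewrite negb_imply negbK => /andP[s's ys']; apply/bigcupP; exists s'; first by rewrite !inE s's.
    by rewrite inE sy.
  have := leq_trans (hdeg s) (subset_leq_card sub).
  move=> /leq_trans/(_ (leq_card_setU _ _)) hU.
  have hc : #|\bigcup_(s' in S :\ s) two s s'| <= q * b.
    apply: leq_trans (card_bigcup_leq _ _) _; apply: leq_trans (_ : \sum_(s' in S :\ s) b <= _).
      by apply: leq_sum => s'; rewrite !inE => /andP[s's s'S]; apply: few => //; rewrite eq_sym.
    rewrite sum_nat_const leq_mul2r (leq_trans _ cq) ?orbT // -cS subset_leq_card //.
    exact: subsetDl.
  move: hU hc hqb; clear; nia.
(* At most $q^2b$ of the level-0 links of [v] lie in the overlaps [two s s']; the rest are spread
   over at most [q] sets [U s], one of which receives [b] of them. *)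
have home v : exists2 s, s \in S & b <= #|[set w in U s | link r v w]|.
  apply/exists_inP; apply: contraT; rewrite negb_exists_in => /forall_inP hv.
  have sub : [set y | link 0 v y] \subset
      (\bigcup_(s in S) [set w in U s | link r v w]) :|: \bigcup_(s in S) \bigcup_(s' in S :\ s) two s s'.
    apply/subsetP => y; rewrite inE => /(link_mono (leq0n r)) vy; rewrite in_setU.
    have [s sS ys] := cover y; have [yU|] := boolP (y \in U s).
      by apply/orP; left; apply/bigcupP; exists s; rewrite // inE yU.
    rewrite inE ys /= negb_forall_in => /exists_inP[s' s'S].
    rewrite negb_imply negbK => /andP[s's ys']; apply/orP; right.
    apply/bigcupP; exists s => //; apply/bigcupP; exists s'; first by rewrite !inE s's.
    by rewrite inE link_sym ys.
  have := leq_trans (hdeg v) (subset_leq_card sub).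
  move=> /leq_trans/(_ (leq_card_setU _ _)) hU.
  have h1 : #|\bigcup_(s in S) [set w in U s | link r v w]| + #|S| <= q * b.
    apply: leq_trans (leq_add (card_bigcup_leq _ _) (leqnn _)) _.
    rewrite -sum1_card -big_split /=; apply: leq_trans (_ : \sum_(s in S) b <= _).
      by apply: leq_sum => s /hv; rewrite -ltnNge addn1.
    by rewrite sum_nat_const cS leq_mul2r cq orbT.
  have h2 : #|\bigcup_(s in S) \bigcup_(s' in S :\ s) two s s'| <= q * q * b.
    apply: leq_trans (card_bigcup_leq _ _) _; apply: leq_trans (_ : \sum_(s in S) q * b <= _).
      apply: leq_sum => s sS.
      apply: leq_trans (card_bigcup_leq _ _) _; apply: leq_trans (_ : \sum_(s' in S :\ s) b <= _).
        by apply: leq_sum => s'; rewrite !inE => /andP[s's s'S]; apply: few => //; rewrite eq_sym.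
      rewrite sum_nat_const leq_mul2r (leq_trans _ cq) ?orbT // -cS subset_leq_card //.
      exact: subsetDl.
    by rewrite sum_nat_const cS -mulnA leq_mul2r cq orbT.
  by exfalso; move: hU h1 h2 hqb; rewrite cS; move: c0; clear; lia.
pose cls v := if [pick s in S | v \in U s] is Some s then s
  else odflt x0 [pick s in S | b <= #|[set w in U s | link r v w]|].
have clsS v : cls v \in S.
  rewrite /cls; case: pickP => [s /andP[]//|_]; case: pickP => [s /andP[]//|none].
  by have [s sS hs] := home v; have := none s; rewrite sS hs.
have clsU v s : s \in S -> v \in U s -> cls v = s.
  move=> sS vU; rewrite /cls; case: pickP => [s' /andP[s'S vU']|/(_ s)]; last by rewrite sS vU.
  apply/eqP; apply: contraT => s's; have [_ /(_ s' s'S s's)] := UP _ _ vU.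
  by have [-> _] := UP _ _ vU'.
(* Replacing [s] in [S] by [v] and [w] gives $c+1$ vertices, hence a linked pair; every pair other
   than [v], [w] is excluded. *)
have inU s v w : s \in S -> v \in U s -> w \in U s -> link r v w.
  move=> sS vU wU; have [->//|vw] := eqVneq v w.
  have [lvs nv] := UP _ _ vU; have [lws nw] := UP _ _ wU.
  have [vS wS] : v \notin S :\ s /\ w \notin S :\ s.
    by split; rewrite in_setD1; apply/negP => /andP[xs xS];
      [have := nv _ xS xs | have := nw _ xS xs]; rewrite refl.
  have [|x [y [xS yS xy lk]]] := pair (v |: (w |: (S :\ s))).
    rewrite cardsU1 in_setU1 (negbTE vw) (negbTE vS) cardsU1 (negbTE wS) /=.
    by have := cardsD1 s S; rewrite sS cS; clear; lia.
  have noS z z' : z \in S :\ s -> z' \in [set v; w] -> ~~ link r z z'.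
    rewrite in_setD1 => /andP[zs zS] /set2P[]->; rewrite link_sym; [exact: nv|exact: nw].
  move: xS yS; rewrite 4!in_setU1 => /or3P[/eqP ex|/eqP ex|xS] /or3P[/eqP ey|/eqP ey|yS].
  - by rewrite ex ey eqxx in xy.
  - by rewrite -ex -ey.
  - by have := noS y x yS; rewrite link_sym lk ex => /(_ (set21 _ _)).
  - by rewrite link_sym -ex -ey.
  - by rewrite ex ey eqxx in xy.
  - by have := noS y x yS; rewrite link_sym lk ex => /(_ (set22 _ _)).
  - by have := noS x y xS; rewrite lk ey => /(_ (set21 _ _)).
  - by have := noS x y xS; rewrite lk ey => /(_ (set22 _ _)).
  move: xS yS; rewrite !in_setD1 => /andP[_ xS] /andP[_ yS].
  by have := apart x y xS yS xy; rewrite (link_mono (leqnSn r) lk).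
have toU v w : w \in U (cls v) -> link r.+1 v w.
  have := clsS v; rewrite /cls; case: pickP => [s /andP[_ vU] sS wU|_].
    exact: link_mono (leqnSn r) (inU _ _ _ sS vU wU).
  case: pickP => [s /andP[_ hs] sS wU|none]; last first.
    by have [s sS hs] := home v; have := none s; rewrite sS hs.
  apply: link_trans hs _ => z; rewrite inE => /andP[zU vz]; split=> //.
  exact: (inU s).
exists S, cls; split=> // [|x y exy|s sS]; first by rewrite cS.
  (* Both vertices are linked at level [r.+1] to all of [U (cls x)]; $c \ge 1$ gives the bound on
     the level. *)
  apply: link_mono (_ : r.+2 <= q.+1) _; first by rewrite /r; lia.
  apply: link_trans (bigU _ (clsS x)) _ => w wU; split; first exact: toU.
  by rewrite link_sym; apply: toU; rewrite -exy.
rewrite (leq_trans (bigU s sS)) // subset_leq_card //; apply/subsetP => x xU.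
by rewrite inE (clsU x s).
Qed.

End Links.

(** * Exchange gadgets *)

Section Swaps.
Variables (T : finType) (e : rel T) (k a : nat).
Hypotheses (esym : symmetric e) (eirr : irreflexive e) (k3 : 3 <= k).
Hypothesis rich : forall U : {set T}, a < #|U| ->
  exists A : {set T}, [/\ A \subset U, #|A| = k.-1 & clique e A].
Local Notation neigh := (neigh e).
Local Notation tile := (tile e k).
Local Notation tileable := (tileable e k).

(** [F] stands for the vertices already in use; being able to avoid every [F] of size [m] is what
    allows greedy choices of disjoint gadgets. *)
Definition swap (K m : nat) (u v : T) := forall F : {set T}, #|F| <= m ->
  exists A : {set T}, [/\ [disjoint A & F], u \notin A, v \notin A, #|A| <= K &
    tileable (u |: A) /\ tileable (v |: A)].

Fixpoint gadget_size (r : nat) := if r is r'.+1 then (gadget_size r').*2.+1 else k.-1.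

Fixpoint gadget_slack (r : nat) :=
  if r is r'.+1 then gadget_slack r' + gadget_size r' + 2 else 0.

(** At level 0 a clique in the common neighbourhood serves both vertices. At the next level, gadgets
    $A$ for $u, w$ and $B$ for $w, v$ combine to $A \cup \{w\} \cup B$: with $u$ it splits as $uA$,
    $wB$, and with $v$ as $wA$, $vB$. [gadget_slack] counts the additional vertices that the
    recursive calls must avoid. *)
Lemma link_swap b r m u v : link e b r u v -> a + m + gadget_slack r < b -> swap (gadget_size r) m u v.
Proof.
elim: r m u v => [|r IH] m u v /=; rewrite ?addn0 => uv mb F Fm.
  have [|A [AU cA clA]] := rich (U := (neigh u :&: neigh v) :\: F).
    by rewrite cardsD; have := subset_leq_card (subsetIr (neigh u :&: neigh v) F); lia.
  have [Au Av dAF] : [/\ A \subset neigh u, A \subset neigh v & [disjoint A & F]].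
    by split; set_tac.
  have nA w : A \subset neigh w -> w \notin A.
    by move=> /subsetP Aw; apply/negP => /Aw; rewrite inE eirr.
  exists A; split; rewrite ?nA ?cA //.
  by split; apply: tileable1; apply: (tile_neigh esym eirr k3 clA).
have [uv'|far] := boolP (link e b r u v).
  have [|A [dA uA vA cA tA]] := IH m u v uv' _ F Fm; first by lia.
  by exists A; split=> //; lia.
rewrite (negbTE far) /= in uv.
have [w /andP[wuv wF]] : exists w, (w \in [set w | link e b r u w && link e b r w v]) && (w \notin u |: (v |: F)).
  have [/subsetPn[w h1 h2]|sub] := boolP (~~ ([set w | link e b r u w && link e b r w v] \subset u |: (v |: F))).
    by exists w; rewrite h1.
  have := subset_leq_card (negbNE sub); rewrite !cardsU1.
  by have := leq_b1 (u \notin v |: F); have := leq_b1 (v \notin F); lia.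
move: wuv; rewrite inE => /andP[uw wv].
have [||A [dA uA wA cA [tuA twA]]] := IH m.+1 u w uw _ (v |: F); [lia| |].
  by rewrite cardsU1; case: (v \notin F); lia.
have [||B [dB wB vB cB [twB tvB]]] := IH (m + gadget_size r).+1 w v wv _ (u |: (F :|: A)); [lia| |].
  rewrite cardsU1 (leq_trans (leq_add (leq_b1 _) (leqnn _))) // add1n ltnS.
  by rewrite (leq_trans (leq_card_setU _ _)) // leq_add.
have [vA uB] : v \notin A /\ u \notin B.
  by rewrite (disjointFl dA) ?(disjointFl dB) ?setU11.
exists (A :|: (w |: B)); split.
- have wF' : w \notin F by set_tac.
  by set_tac.
- by set_tac.
- by set_tac.
- rewrite (leq_trans (leq_card_setU _ _)) // -addnn -addnS leq_add // cardsU1.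
  by rewrite (leq_trans (leq_add (leq_b1 _) (leqnn _))).
split.
  rewrite setUA; apply: tileable_setU => //; set_tac.
rewrite (_ : v |: _ = (w |: A) :|: (v |: B)); last by set_tac.
by apply: tileable_setU => //; set_tac.
Qed.

End Swaps.

(** * Absorbing sets *)

Lemma disjoint_setU2r (T : finType) (A B C : {set T}) :
  [disjoint A & B :|: C] = [disjoint A & B] && [disjoint A & C].
Proof.
apply/idP/andP => [dABC|[dAB dAC]]; last by set_tac.
by split; set_tac.
Qed.

(** The sets are chosen one by one, each avoiding [F0] and its predecessors, which never exceed the
    budget [m]. *)
Lemma greedy_family (T J : finType) (Pr : J -> {set T} -> Prop) (s m : nat) (F0 : {set T}) :
    (forall j (F : {set T}), #|F| <= m -> exists A : {set T}, [/\ [disjoint A & F], #|A| <= s & Pr j A]) ->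
    #|F0| + #|J| * s <= m ->
  exists A : J -> {set T},
    (forall j, [/\ [disjoint A j & F0], #|A j| <= s & Pr j (A j)]) /\
    (forall j j', j != j' -> [disjoint A j & A j']).
Proof.
move=> hPr hm.
have [A [hA1 hA2 _]] : exists A : J -> {set T}, [/\
    forall j, j \in enum J -> [/\ [disjoint A j & F0], #|A j| <= s & Pr j (A j)],
    forall j j', j \in enum J -> j' \in enum J -> j != j' -> [disjoint A j & A j'] &
    #|\bigcup_(j <- enum J) A j| <= size (enum J) * s]; last first.
  by exists A; split=> [j|j j' jj']; [apply: hA1 | apply: hA2] => //; rewrite mem_enum.
rewrite [#|J|]cardE in hm; elim: (enum J) (enum_uniq J) hm => [|j r IH] /=.
  by exists (fun=> set0); split=> //; rewrite big_nil cards0.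
move=> /andP[jr ur] hm; have [|A [A1 A2 A3]] := IH ur; first by rewrite (leq_trans _ hm) // leq_add2l leq_mul2r leqnSn orbT.
have [|B [dB cB PB]] := hPr j (F0 :|: \bigcup_(j <- r) A j).
  rewrite (leq_trans (leq_card_setU _ _)) // (leq_trans _ hm) // leq_add2l.
  by rewrite (leq_trans A3) // leq_mul2r leqnSn orbT.
have [dB0 dBA] : [disjoint B & F0] /\ [disjoint B & \bigcup_(j <- r) A j] by split; set_tac.
have dBr i : i \in r -> [disjoint B & A i].
  by move=> ir; apply: disjointWr dBA; rewrite -[A i]/(A i) (big_rem i) //= subsetUl.
exists (fun i => if i == j then B else A i); split.
- move=> i; rewrite in_cons; case: (eqVneq i j) => [-> _ //|_ ir]; exact: A1.
- move=> i i'; rewrite !in_cons; case: (eqVneq i j) => [->|_]; case: (eqVneq i' j) => [->|_] //=.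
  + by move=> _ ir _; apply: dBr.
  + by move=> ir _ _; rewrite disjoint_sym; apply: dBr.
  exact: A2.
rewrite big_cons eqxx mulSn (leq_trans (leq_card_setU _ _)) // leq_add //.
rewrite big_seq (eq_bigr A) -?big_seq // => i ir.
by case: eqP ir jr => // -> ->.
Qed.

Section Absorbers.
Variables (T : finType) (e : rel T) (k a : nat).
Hypotheses (esym : symmetric e) (eirr : irreflexive e) (k3 : 3 <= k).
Hypothesis rich : forall U : {set T}, a < #|U| ->
  exists A : {set T}, [/\ A \subset U, #|A| = k.-1 & clique e A].
Local Notation neigh := (neigh e).
Local Notation tile := (tile e k).
Local Notation tileable := (tileable e k).
Variables (I : finType) (cls : T -> I).

Definition class (i : I) : {set T} := [set x | cls x == i].

Lemma in_class x i : (x \in class i) = (cls x == i).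
Proof. by rewrite inE. Qed.

Definition mixed_tiles (m : nat) (i j : I) := forall F : {set T}, #|F| <= m ->
  exists x (A : {set T}), [/\ [disjoint x |: A & F], x \in class i,
    A \subset class j, #|A| = k.-1 & tile (x |: A)].

Lemma mixed_tile_notin x (A : {set T}) : #|A| = k.-1 -> tile (x |: A) -> x \notin A.
Proof.
move=> cA /andP[/eqP cxA _]; apply/negP => xA.
by move: cxA; rewrite cardsU1 xA cA /= add0n; move: k3; clear; lia.
Qed.

(** With so many edges, more than [m] vertices of class [i] have over $a+m$ neighbours in class [j].
    One of them lies outside [F], and its neighbourhood in class [j] contains a clique outside
    [F]. *)
Lemma mixed_tiles_dense m i j :
  (m * 2 + a) * #|T| < \sum_(x in class i) #|neigh x :&: class j| -> mixed_tiles m i j.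
Proof.
move=> dense F Fm; pose H := [set x in class i | a + m < #|neigh x :&: class j|].
have bigH : m < #|H|.
  rewrite ltnNge; apply: contraL dense => smallH; rewrite -leqNgt.
  rewrite (bigID (mem H)) /=.
  apply: leq_trans (_ : #|H| * #|T| + #|T| * (a + m) <= _); last first.
    have := leq_mul smallH (leqnn #|T|); move: #|H| #|T| => u v; clear; nia.
  rewrite leq_add //.
    rewrite -sum_nat_const (eq_bigl (mem H)) => [|x]; last first.
      by rewrite /H !inE; case: (cls x == i).
    by apply: leq_sum => x _; apply: max_card.
  rewrite -cardsT -sum_nat_const big_mkcond [X in _ <= X]big_mkcond /=; apply: leq_sum => x _.
  by rewrite in_setT; case: ifP => //; rewrite !inE => /andP[-> /=]; rewrite -leqNgt.
have [x xH xF] : exists2 x, x \in H & x \notin F.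
  by apply/subsetPn/negP => /subset_leq_card; rewrite leqNgt (leq_ltn_trans Fm).
move: xH; rewrite inE => /andP[xi big].
have [|A [AU cA clA]] := rich (U := (neigh x :&: class j) :\: F).
  by rewrite cardsD; have := subset_leq_card (subsetIr (neigh x :&: class j) F); move: big Fm; clear; lia.
have [Ax Aj AF] : [/\ A \subset neigh x, A \subset class j & [disjoint A & F]] by split; set_tac.
exists x, A; split=> //; first by set_tac.
exact: (tile_neigh esym eirr k3).
Qed.

(** Averaging over [j] finds a dense pair of classes; the edge count is symmetric by [double_count],
    so tiles of both orientations exist. *)
Lemma exists_mixed_tiles m D i : (forall x, D <= #|neigh x|) ->
    #|I| * ((m * 2 + a) * #|T|) < #|class i| * D ->
  exists j, mixed_tiles m i j /\ mixed_tiles m j i.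
Proof.
move=> hD hi.
have tot : #|class i| * D <= \sum_(j : I) \sum_(x in class i) #|neigh x :&: class j|.
  rewrite exchange_big -sum_nat_const /=; apply: leq_sum => x _; apply: leq_trans (hD x) _.
  apply: leq_trans (card_bigcup_leq _ _); rewrite subset_leq_card //; apply/subsetP => y xy.
  by apply/bigcupP; exists (cls y); rewrite // inE xy inE eqxx.
have [j hj] : exists j, (m * 2 + a) * #|T| < \sum_(x in class i) #|neigh x :&: class j|.
  apply/existsP; apply: contraLR hi; rewrite negb_exists => /forallP none.
  rewrite -leqNgt (leq_trans tot) // -sum_nat_const leq_sum // => j _.
  by rewrite leqNgt none.
exists j; split; apply: mixed_tiles_dense => //.
by rewrite -double_count.
Qed.

Variables (K m : nat) (f : I -> I).
Hypothesis swaps : forall u v, cls u = cls v -> swap e k K m u v.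
Hypothesis fans : forall i, mixed_tiles m i (f i).

(** Exchanges [s] for [t] coordinate by coordinate. Every pair takes $K+2$ from the budget: a gadget
    and the two vertices themselves. *)
Lemma swap_seq (s t : seq T) (F : {set T}) : size s = size t -> uniq (s ++ t) ->
    map cls s = map cls t -> #|F| + size s * (K + 2) <= m ->
  exists A : {set T}, [/\ [disjoint A & F :|: [set z in s ++ t]], #|A| <= size s * K,
    tileable (A :|: [set z in s]) & tileable (A :|: [set z in t])].
Proof.
elim: s t F => [|x s IH] [|y t] F //=.
  move=> _ _ _ _; exists set0; rewrite cards0 set0U; split=> //; first by set_tac.
    by rewrite set_nil; apply: tileable_set0.
  by rewrite set_nil; apply: tileable_set0.
move=> [st] u [cxy cst] hF.
have perm : perm_eq (x :: s ++ y :: t) (x :: y :: s ++ t) by rewrite perm_cons perm_catC /= perm_cons perm_catC.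
have : uniq (x :: y :: s ++ t) by rewrite -(perm_uniq perm).
rewrite /= in_cons negb_or => /and3P[/andP[xy xst] yst ust].
have cst' : #|[set z in s ++ t]| <= size s * 2.
  by rewrite cardsE (leq_trans (card_size _)) // size_cat -st muln2 addnn.
have [|A1 [dA1 xA1 yA1 cA1 [tx ty]]] := swaps cxy (F := F :|: [set z in s ++ t]).
  rewrite (leq_trans (leq_card_setU _ _)) // (leq_trans _ hF) // leq_add2l (leq_trans cst') //.
  by clear; nia.
have [|A2 [dA2 cA2 ts tt]] := IH t (x |: (y |: (F :|: A1))) st ust cst.
  rewrite (leq_trans _ hF) // mulSn addnA leq_add2r !cardsU1.
  have := leq_card_setU F A1; case => + _; move: (cA1).
  have := leq_b1 (x \notin y |: (F :|: A1)); have := leq_b1 (y \notin F :|: A1).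
  by clear; lia.
have xs : x \notin [set z in s ++ t] by rewrite inE.
have ys : y \notin [set z in s ++ t] by rewrite inE.
have cat : [set z in s ++ t] = [set z in s] :|: [set z in t].
  by apply/setP => z; rewrite !inE mem_cat.
have cat' : [set z in x :: s ++ y :: t] = x |: (y |: [set z in s ++ t]).
  apply/setP => z; rewrite inE (perm_mem perm) !in_cons !in_setU1.
  by rewrite [z \in [set _ in _]]inE.
have cons z r : [set z' in z :: r] = z |: [set z' in r] :> {set T}.
  by apply/setP => z'; rewrite !inE.
exists (A1 :|: A2); rewrite cat' !cons; rewrite cat in dA1 dA2 xs ys *; split.
- set_tac.
- by rewrite (leq_trans (leq_card_setU _ _)) // mulSn leq_add.
- rewrite (_ : _ :|: _ = (x |: A1) :|: (A2 :|: [set z in s])); last by set_tac.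
  by apply: tileable_setU => //; set_tac.
rewrite (_ : _ :|: _ = (y |: A1) :|: (A2 :|: [set z in t])); last by set_tac.
by apply: tileable_setU => //; set_tac.
Qed.

Definition absorber_size := k * K + k.

(** Take a tile $\{y\} \cup B$ with the same classes as $\{x\} \cup Z$, and gadgets exchanging the
    two. The gadgets are tiled with $y, B$ when nothing is absorbed; otherwise they are tiled with
    $x, Z$, and $\{y\} \cup B$ is a tile of its own. *)
Lemma absorber i x (Z F : {set T}) : x \in class i -> Z \subset class (f i) ->
    x \notin Z -> #|Z| = k.-1 -> #|F| + k * (K + 3) <= m ->
  exists A : {set T}, [/\ [disjoint A & F], #|A| <= absorber_size &
    [/\ [disjoint A & x |: Z], tileable A & tileable (A :|: (x |: Z))]].
Proof.
move=> xi Zi xZ cZ hF; have k0 : 0 < k by apply: leq_trans k3.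
have [|y [B [dyB yi Bi cB tB]]] := @fans i (F :|: (x |: Z)).
  rewrite (leq_trans (leq_card_setU _ _)) // cardsU1 xZ cZ add1n prednK //.
  by rewrite (leq_trans _ hF) // leq_add2l leq_pmulr // addn3.
have yB := mixed_tile_notin cB tB.
have [yF dB] : y \notin F :|: (x |: Z) /\ [disjoint B & F :|: (x |: Z)] by split; set_tac.
have sz : size (enum Z) = k.-1 by rewrite -cardE.
have szB : size (enum B) = k.-1 by rewrite -cardE.
have clsE (C : {set T}) j : C \subset class j -> map cls (enum C) = nseq #|C| j.
  move=> sub; rewrite cardE -(size_map cls); apply/all_pred1P/allP => _ /mapP[z zC ->].
  by move: zC; rewrite mem_enum => /(subsetP sub); rewrite in_class.
have [||||A [dA cA t1 t2]] := @swap_seq (x :: enum Z) (y :: enum B) F.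
- by rewrite /= sz szB.
- rewrite cat_uniq; apply/and3P; split; rewrite ?cons_uniq ?mem_enum ?xZ ?yB ?enum_uniq //.
  apply/hasPn => z; rewrite !in_cons !mem_enum => zyB.
  by have := disjointFr dyB (x := z); rewrite !inE zyB => /(_ isT) /negbT; rewrite !negb_or => /andP[_].
- rewrite /=; congr (_ :: _).
    by move: xi yi; rewrite !in_class => /eqP-> /eqP->.
  by rewrite !(clsE _ (f i)) // cZ cB.
- rewrite /= sz prednK // (leq_trans _ hF) // leq_add2l leq_mul2l; apply/orP; right.
  by rewrite leq_add2l.
have eZ : [set z in x :: enum Z] = x |: Z by apply/setP => z; rewrite !inE mem_enum.
have eB : [set z in y :: enum B] = y |: B by apply/setP => z; rewrite !inE mem_enum.
have eU : [set z in (x :: enum Z) ++ y :: enum B] = (x |: Z) :|: (y |: B).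
  by rewrite -eZ -eB; apply/setP => z; rewrite in_setU [LHS]inE mem_cat; congr (_ || _); rewrite inE.
rewrite eU in dA; rewrite eZ in t1; rewrite eB in t2.
rewrite /= sz prednK // in cA.
exists (A :|: (y |: B)); split.
- set_tac.
- rewrite (leq_trans (leq_card_setU _ _)) // leq_add //.
  by have /andP[/eqP-> _] := tB.
split=> //; first by set_tac.
rewrite (_ : _ :|: _ = (A :|: (x |: Z)) :|: (y |: B)); last by set_tac.
by apply: tileable_setU => //; [apply: tileable1|set_tac].
Qed.

Hypothesis big_classes : forall i, m <= #|class i|.

(** Per vertex of [X]: 2 for the set [Y], $3k$ for at most 3 cliques, and an absorber for each of
    the 114 template edges. *)
Definition template_size := 2 + 3 * k + 114 * absorber_size.

(** The template joins $X \cup Y$ to $z = 2|X| + \mu$ disjoint cliques $B_t$ in class $f(i)$, and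
    each edge gets its own absorber. Given $X'$ of size $\mu$, the template has a perfect matching
    between $X' \cup Y$ and the $B_t$; absorbers of matched edges absorb their edge, and the others
    are tiled alone. *)
Lemma class_absorber i (X F : {set T}) (mu : nat) : X \subset class i -> 0 < #|X| -> mu <= #|X| ->
    #|F| + #|X| + template_size * #|X| + k * (K + 3) <= m ->
  exists A : {set T}, [/\ [disjoint A & F :|: X], #|A| <= template_size * #|X| &
    forall X' : {set T}, X' \subset X -> #|X'| = mu -> tileable (A :|: X')].
Proof.
move=> Xi X0 muX hm; have k0 : 0 < k by apply: leq_trans k3.
set n := #|X| in X0 muX hm *; pose z := n * 2 + mu.
pose s := absorber_size.
have ts : template_size * n = n * 2 + 3 * k * n + 114 * n * s.
  by rewrite /template_size -/s; move: (s); clear; lia.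
rewrite ts in hm *.
have zn : z <= 3 * n by rewrite /z; move: muX; clear; lia.
have [Y YC cY] : exists2 Y : {set T}, Y \subset class i :\: (F :|: X) & #|Y| = n * 2.
  apply: exists_subset_card; rewrite cardsD.
  have h1 := subset_leq_card (subsetIr (class i) (F :|: X)).
  have h2 : #|F :|: X| <= #|F| + n := leq_card_setU F X.
  by have := big_classes i; move: h1 h2 hm; clear; lia.
have [Yi dYF dYX] : [/\ Y \subset class i, [disjoint Y & F] & [disjoint Y & X]].
  by split; set_tac.
pose F1 := F :|: X :|: Y.
have cF1 : #|F1| <= #|F| + n + n * 2.
  rewrite /F1 (leq_trans (leq_card_setU _ _)) // cY leq_add2r.
  exact: leq_card_setU.
have [||B [B1 dB]] := @greedy_family T 'I_z
    (fun _ A => A \subset class (f i) /\ #|A| = k.-1) k.-1 m F1.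
- move=> _ G Gm; have [|x [A [dA xi Ai cA tA]]] := @fans i G; first by [].
  by exists A; split; rewrite ?cA //; set_tac.
- rewrite card_ord; apply: leq_trans hm.
  have : z * k.-1 <= 3 * k * n.
    by rewrite -mulnA [k * n]mulnC mulnA leq_mul // leq_pred.
  by move: cF1; clear; lia.
pose F2 := F1 :|: \bigcup_j B j.
have cF2 : #|F2| <= #|F| + n + n * 2 + 3 * k * n.
  rewrite /F2 (leq_trans (leq_card_setU _ _)) // leq_add //.
  apply: leq_trans (card_bigcup_leq _ _) _.
  apply: leq_trans (_ : \sum_(j < z) k.-1 <= _).
    by apply: leq_sum => j _; have [] := B1 j.
  by rewrite sum_nat_const card_ord -mulnA [k * n]mulnC mulnA leq_mul // leq_pred.
pose XT := {x : T | x \in X}; pose YT := {x : T | x \in Y}.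
have cXT : #|{: XT}| = n by rewrite card_sig.
have cYT : #|{: YT}| = n * 2 by rewrite card_sig.
have [E cE hE] : exists2 E : {set (XT + YT) * 'I_z}, #|E| <= 114 * #|{: XT}| &
    forall X' : {set XT}, #|X'| + #|{: YT}| = #|'I_z| ->
      exists g : XT + YT -> 'I_z, [/\ {in remaining YT X' &, injective g},
        forall p, p \in remaining YT X' -> (p, g p) \in E & g @: remaining YT X' = setT].
  by apply: robust_template; rewrite ?cXT ?cYT ?card_ord ?muln2 // -muln2 leq_addr.
pose pv (p : XT + YT) : T := match p with inl x => val x | inr y => val y end.
have pvXY p : pv p \in X :|: Y by case: p => -[x xX] /=; rewrite in_setU xX ?orbT.
have pv_inj : injective pv.
  move=> [[x xX]|[x xX]] [[y yX]|[y yX]] /= exy; try by (congr inl + congr inr); apply: val_inj.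
    by exfalso; rewrite -exy in yX; have := disjointFr dYX yX; rewrite xX.
  by exfalso; rewrite exy in xX; have := disjointFr dYX xX; rewrite yX.
have pvi p : pv p \in class i.
  by have := pvXY p; rewrite in_setU => /orP[/(subsetP Xi)|/(subsetP Yi)].
pose J := {p : (XT + YT) * 'I_z | p \in E}.
have cJ : #|{: J}| <= 114 * n by rewrite card_sig -cXT.
pose key (j : J) : (XT + YT) * 'I_z := val j.
pose core (j : J) := pv (key j).1 |: B (key j).2.
have coreF2 j : core j \subset F2.
  have h1 := pvXY (key j).1; have h2 : B (key j).2 \subset \bigcup_j B j by exact: bigcup_sup.
  by rewrite /core /F2 /F1; set_tac.
have pvB p t : pv p \notin B t.
  have [dBt _ _] := B1 t; have h1 := pvXY p.
  by rewrite /F1 in dBt; set_tac.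
(* Subtracting $k(K+3)$ from the budget leaves the room that each call of [absorber] needs. *)
have [||A [A1 dA]] := @greedy_family T J
    (fun j A => tileable A /\ tileable (A :|: core j)) s (m - k * (K + 3)) F2.
- move=> j G Gm.
  have [_ _ [Bi cB]] := B1 (key j).2.
  have [|A [dA cA [_ tA tAc]]] := absorber (F := G) (pvi (key j).1) Bi (pvB _ _) cB.
    by move: Gm hm; clear; lia.
  by exists A.
- apply: leq_trans (leq_add cF2 (leq_mul cJ (leqnn s))) _; move: hm; clear; lia.
pose act X' (g : XT + YT -> 'I_z) (j : J) := (g (key j).1 == (key j).2) && ((key j).1 \in remaining YT X').
exists (Y :|: \bigcup_t B t :|: \bigcup_j A j); split.
- rewrite disjoint_sym !disjoint_setU2r -andbA; apply/and3P; split.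
  + by set_tac.
  + apply: bigcup_disjoint => t _; have [dt _ _] := B1 t; rewrite /F1 in dt; set_tac.
  apply: bigcup_disjoint => j _; have [dj _ _] := A1 j; rewrite /F2 /F1 in dj; set_tac.
- rewrite (leq_trans (leq_card_setU _ _)) // leq_add //.
    rewrite (leq_trans (leq_card_setU _ _)) // leq_add //; first by rewrite cY.
    apply: leq_trans (card_bigcup_leq _ _) _; apply: leq_trans (_ : \sum_(t < z) k.-1 <= _).
      by apply: leq_sum => t _; have [] := B1 t.
    by rewrite sum_nat_const card_ord -mulnA [k * n]mulnC mulnA leq_mul // leq_pred.
  apply: leq_trans (card_bigcup_leq _ _) _; apply: leq_trans (_ : \sum_(j : J) s <= _).
    by apply: leq_sum => j _; have [] := A1 j.
  by rewrite sum_nat_const leq_mul2r cJ orbT.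
move=> X' X'X cX'; pose X'' : {set XT} := [set x | val x \in X'].
have cX'' : #|X''| = mu.
  rewrite -cX' -(card_imset _ (@val_inj _ _ XT)); apply: eq_card => x; apply/imsetP/idP.
    by case=> y; rewrite inE => yX' ->.
  by move=> xX'; exists (exist _ x (subsetP X'X x xX')); rewrite ?inE.
have [|g [gi gE gT]] := hE X''; first by rewrite cX'' cYT card_ord /z addnC.
pose blk j := A j :|: (if act X'' g j then core j else set0).
have -> : Y :|: \bigcup_t B t :|: \bigcup_j A j :|: X' = \bigcup_j blk j.
  have cover p : p \in remaining YT X'' -> pv p |: B (g p) \subset \bigcup_j blk j.
    move=> pr; apply: (bigcup_max (exist _ (p, g p) (gE p pr) : J)) => //.
    by rewrite /blk /act /= eqxx pr subsetUr.
  apply/eqP; rewrite eqEsubset; apply/andP; split; last first.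
    apply/bigcupsP => j _; rewrite /blk; apply/subUsetP; split.
      by have hA : A j \subset \bigcup_j A j; [exact: bigcup_sup | set_tac].
    case: ifP => [/andP[_ jr]|_]; last by rewrite sub0set.
    have h1 : B (key j).2 \subset \bigcup_t B t by exact: bigcup_sup.
    have h2 : pv (key j).1 \in Y :|: X'.
      by move: jr; rewrite inE; case: (key j).1 => -[x xX] /=; rewrite ?inE /= => hx; rewrite ?xX ?hx ?orbT.
    by rewrite /core; set_tac.
  rewrite !subUset -!andbA; apply/and4P; split.
  - apply/subsetP => y yY; have := cover (inr (exist _ y yY : YT)); rewrite inE => /(_ isT)/subsetP.
    by apply; rewrite setU11.
  - apply/bigcupsP => t _; have : t \in g @: remaining YT X'' by rewrite gT.
    by case/imsetP => p pr ->; apply: subset_trans (cover p pr); rewrite subsetUr.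
  - by apply/bigcupsP => j _; apply: (bigcup_max j) => //; rewrite subsetUl.
  apply/subsetP => x xX'; have := cover (inl (exist _ x (subsetP X'X x xX') : XT)).
  by rewrite !inE => /(_ xX')/subsetP; apply; rewrite setU11.
apply: tileable_bigcup => [j _|j j' _ _ jj'].
  have [_ _ [tA tAc]] := A1 j; rewrite /blk; case: ifP => // _.
  by rewrite setU0.
(* As [g] is injective on the remaining vertices, distinct matched edges share neither endpoint. *)
have core_dis : act X'' g j -> act X'' g j' -> [disjoint core j & core j'].
  move=> /andP[/eqP gt pr] /andP[/eqP gt' pr'].
  have pp' : (key j).1 != (key j').1.
    apply: contra jj' => /eqP epp; apply/eqP/val_inj.
    by rewrite [LHS]surjective_pairing [RHS]surjective_pairing -gt -gt' epp.
  have tt' : (key j).2 != (key j').2 by rewrite -gt -gt'; apply: contra pp' => /eqP/gi->.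
  have ne : pv (key j).1 != pv (key j').1 by apply: contra pp' => /eqP/pv_inj->.
  have dBB := dB _ _ tt'; have n1 := pvB (key j).1 (key j').2; have n2 := pvB (key j').1 (key j).2.
  rewrite /core; set_tac.
have [dj _ _] := A1 j; have [dj' _ _] := A1 j'; have djj' := dA j j' jj'.
have cj := coreF2 j; have cj' := coreF2 j'.
rewrite /blk; case: ifP core_dis => [aj|_] core_dis; case: ifP core_dis => [aj'|_] core_dis.
- have dcc := core_dis isT isT; set_tac.
- set_tac.
- set_tac.
- set_tac.
Qed.

End Absorbers.

(** * Assembling the tiling *)

Lemma card_bigcup_disjoint (T J : finType) (D : pred J) (F : J -> {set T}) :
  (forall i j, D i -> D j -> i != j -> [disjoint F i & F j]) ->
  #|\bigcup_(j | D j) F j| = \sum_(j | D j) #|F j|.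
Proof.
move=> dF; rewrite big_mkcond [RHS]big_mkcond /= -sum1_card partition_disjoint_bigcup /=.
  by apply: eq_bigr => j _; rewrite sum1_card; case: ifP => // _; rewrite cards0.
move=> i j ij; case: ifP => Di; case: ifP => Dj; [exact: dF|set_tac|set_tac|set_tac].
Qed.

Lemma sum_ord_ltn (n x c : nat) : x <= n -> \sum_(j < n) (if j < x then c else 0) = x * c.
Proof.
move=> xn; rewrite -big_mkcond /= -(big_ord_widen n (fun=> c) xn).
by rewrite sum_nat_const card_ord.
Qed.

Section Assembly.
Variables (T : finType) (e : rel T) (k a : nat).
Hypotheses (esym : symmetric e) (eirr : irreflexive e) (k3 : 3 <= k).
Hypothesis rich : forall U : {set T}, a < #|U| ->
  exists A : {set T}, [/\ A \subset U, #|A| = k.-1 & clique e A].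
Local Notation neigh := (neigh e).
Local Notation tile := (tile e k).
Local Notation tileable := (tileable e k).
Variables (I : finType) (cls : T -> I) (K m : nat) (f : I -> I).
Local Notation class := (class cls).
Hypothesis swaps : forall u v, cls u = cls v -> swap e k K m u v.
Hypothesis fans : forall i, mixed_tiles e k cls m i (f i).
Hypothesis spikes : forall i, mixed_tiles e k cls m (f i) i.
Hypothesis big_classes : forall i, m <= #|class i|.

Definition profile (p : I * bool) (l : I) : nat :=
  if p.2 then spike f k p.1 l else fan f k p.1 l.

Lemma mixed_tile_profile i j l (A : {set T}) x : x \in class i -> A \subset class j ->
  #|A| = k.-1 -> tile (x |: A) -> #|(x |: A) :&: class l| = (l == i) + k.-1 * (l == j).
Proof.
move=> xi /subsetP Aj cA tA; have xA := mixed_tile_notin k3 cA tA.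
rewrite setIUl cards_disjU; last by set_tac.
congr (_ + _).
  move: xi; rewrite in_class => /eqP ex; case: (eqVneq l i) => [->|li].
    by rewrite (setIidPl _) ?cards1 // sub1set in_class ex.
  apply/eqP; rewrite cards_eq0; apply/eqP/setP => y; rewrite !inE.
  by apply/negP => /andP[/eqP-> ]; rewrite ex eq_sym (negbTE li).
case: (eqVneq l j) => [->|lj]; first by rewrite muln1 -cA (setIidPl _) //; apply/subsetP.
rewrite muln0; apply/eqP; rewrite cards_eq0; apply/eqP/setP => y; rewrite !inE.
apply/negP => /andP[/Aj]; rewrite in_class => /eqP ->.
by rewrite eq_sym (negbTE lj).
Qed.

Lemma profiled_tile p (F : {set T}) : #|F| <= m ->
  exists A : {set T}, [/\ [disjoint A & F], #|A| <= k &
    tile A /\ forall l, #|A :&: class l| = profile p l].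
Proof.
case: p => i [] Fm.
  have [x [A [dA xi Ai cA tA]]] := spikes i Fm; exists (x |: A); split=> //.
    by have /andP[/eqP-> _] := tA.
  by split=> // l; rewrite (mixed_tile_profile l xi Ai cA tA) /profile /spike /= addnC.
have [x [A [dA xi Ai cA tA]]] := fans i Fm; exists (x |: A); split=> //.
  by have /andP[/eqP-> _] := tA.
by split=> // l; rewrite (mixed_tile_profile l xi Ai cA tA).
Qed.

Section Designated.
Variables (S : nat) (des : I * bool * 'I_S.*2 -> {set T}).
Hypothesis des_profile : forall j l, #|des j :&: class l| = profile j.1 l.
Hypothesis des_tile : forall j, tile (des j).
Hypothesis des_disjoint : forall j j', j != j' -> [disjoint des j & des j'].

(** Index range $2S$ of the designated tiles is the bound on the coefficients supplied by
    [balance]. *)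
Definition selected (x y : I -> nat) : {set T} :=
  \bigcup_(j : I * bool * 'I_S.*2 | j.2 < if j.1.2 then x j.1.1 else y j.1.1) des j.

Lemma tileable_selected x y : tileable (selected x y).
Proof.
by apply: tileable_bigcup => [j _|j j' _ _]; [apply: tileable1 | apply: des_disjoint].
Qed.

Lemma card_selected x y l : (forall i, x i <= S.*2 /\ y i <= S.*2) ->
  #|selected x y :&: class l| = \sum_i (x i * spike f k i l + y i * fan f k i l).
Proof.
move=> xy; rewrite /selected big_distrl /=.
rewrite card_bigcup_disjoint => [|j j' _ _ /des_disjoint d]; last by set_tac.
rewrite big_mkcond /=.
pose F (p : I * bool) (j : 'I_S.*2) :=
  if j < (if p.2 then x p.1 else y p.1) then profile p l else 0.
transitivity (\sum_j F j.1 j.2); first by apply: eq_bigr => -[p j] _; rewrite /F des_profile.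
rewrite -(pair_bigA _ F) /=.
transitivity (\sum_p (if p.2 then x p.1 else y p.1) * profile p l).
  by apply: eq_bigr => -[i b] _; rewrite /F sum_ord_ltn //; have [] := xy i; case: b.
rewrite -(pair_bigA _ (fun i (b : bool) => (if b then x i else y i) * profile (i, b) l)) /=.
by apply: eq_bigr => i _; rewrite big_bool.
Qed.

End Designated.
(** Set aside the reservoir [Xr], $2S$ spike and fan tiles for every class, and an absorbing set for
    each class. Cover the bad vertices, tile almost all of the rest, and cover the leftover by
    cliques in [Xr]. The damage to [Xr] is balanced by removing spikes and fans, after which every
    class absorbs all but at most $k-1$ of its vertices in [X]. *)
Lemma assembly (Xr Bad : {set T}) (rho g D d S xb : nat) :
    (forall u, u \notin Bad -> rho <= #|neigh u :&: Xr|) -> (forall u, d <= #|neigh u|) ->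
    #|Xr| + #|I| * 2 * S.*2 * k <= xb ->
    xb + #|I| * (template_size k K * xb) + (xb + template_size k K * xb + k * (K + 3)) <= m ->
    a + #|Bad| * k.-1 + (xb + #|I| * (template_size k K * xb)) + #|Bad| < d ->
    D + (xb + #|I| * (template_size k K * xb)) + #|Bad| * k <= d ->
    g.+1 * #|T| <= k * g * D -> 2 * k * g * a <= #|T| ->
    a + 2 * k * g * (a + k) * k.-1 < rho ->
    #|I| * (k * (k - 2)) ^ 2 + (2 * k * g * (a + k) * k.-1).+1 * k <= S ->
  exists2 U : {set T}, tileable U & #|~: U| <= #|I| * k.-1.
Proof.
move=> hXr hd hxb hm hbad hD hg ha hrho hS.
set ts := template_size k K in hm hbad hD; set c := xb + #|I| * (ts * xb) in hm hbad hD.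
set ell := 2 * k * g * (a + k) in hrho hS.
have S0 : 0 < S by apply: leq_trans hS; rewrite (leq_trans _ (leq_addl _ _)) // muln_gt0 /=; apply: leq_trans k3.
have [||des [des1 des_disj]] := @greedy_family T (I * bool * 'I_S.*2)%type
    (fun j A => tile A /\ forall l, #|A :&: class l| = profile j.1 l) k m Xr.
- by move=> j F Fm; apply: profiled_tile.
- rewrite !card_prod card_bool card_ord; apply: leq_trans hxb _.
  by apply: leq_trans hm; rewrite /c -addnA leq_addr.
have des_tile j : tile (des j) by have [_ _ []] := des1 j.
have des_prof j l : #|des j :&: class l| = profile j.1 l by have [_ _ []] := des1 j.
pose X := Xr :|: \bigcup_j des j.
have cX : #|X| <= xb.
  apply: leq_trans hxb; rewrite (leq_trans (leq_card_setU _ _)) // leq_add2l.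
  apply: leq_trans (card_bigcup_leq _ _) _.
  apply: leq_trans (_ : \sum_(j : I * bool * 'I_S.*2) k <= _).
    by apply: leq_sum => j _; have [] := des1 j.
  by rewrite sum_nat_const !card_prod card_bool card_ord.
have selX x y : selected des x y \subset X.
  by apply/bigcupsP => j _; apply: subset_trans (subsetUr _ _); apply: bigcup_sup.
have selXr x y : [disjoint selected des x y & Xr].
  by rewrite disjoint_sym; apply: bigcup_disjoint => j _; have [] := des1 j; rewrite disjoint_sym.
(* The absorbing set of class [l] is set up to expect [dl l] vertices fewer than [X] has there, as
   if [S] tiles of each kind were removed; [balance] attains this afterwards for the actual
   damage. *)
pose dl l := \sum_i (S * spike f k i l + S * fan f k i l).
have dlE l : dl l = #|selected des (fun=> S) (fun=> S) :&: class l|.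
  by rewrite card_selected // => i; rewrite -addnn leq_addr.
have dlX l : dl l <= #|X :&: class l|.
  by rewrite dlE subset_leq_card // setSI.
have dl0 l : 0 < dl l.
  rewrite /dl (bigD1 l) //= ltn_addr // ltn_addl // muln_gt0 S0 /fan eqxx.
  by rewrite addn_gt0.
have [||A [A1 A_disj]] := @greedy_family T I (fun i A => forall X' : {set T},
    X' \subset X :&: class i -> #|X'| = #|X :&: class i| - dl i -> tileable (A :|: X'))
    (ts * xb) (m - (xb + ts * xb + k * (K + 3))) X.
- move=> i F Fm.
  have cXi : #|X :&: class i| <= xb by apply: leq_trans cX; rewrite subset_leq_card // subsetIl.
  have [||||B [dB cB tB]] := class_absorber k3 swaps fans big_classes
    (i := i) (X := X :&: class i) (F := F) (mu := #|X :&: class i| - dl i).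
  + exact: subsetIr.
  + exact: leq_trans (dl0 i) (dlX i).
  + exact: leq_subr.
  + have := leq_mul (leqnn ts) cXi; rewrite -/ts; move: Fm hm cXi; clear; lia.
  exists B; split=> //; first by set_tac.
  by rewrite (leq_trans cB) // leq_mul.
- by move: cX hm; rewrite /c; clear; lia.
pose AA := \bigcup_i A i.
have cAA : #|AA| <= #|I| * (ts * xb).
  apply: leq_trans (card_bigcup_leq _ _) _; rewrite -sum_nat_const.
  by apply: leq_sum => i _; have [] := A1 i.
have dAX : [disjoint AA & X].
  by rewrite disjoint_sym; apply: bigcup_disjoint => i _; have [] := A1 i; rewrite disjoint_sym.
pose P0 := X :|: AA.
have cP0 : #|P0| <= c by rewrite (leq_trans (leq_card_setU _ _)) // leq_add.
have outside u (Q : {set T}) : d <= #|neigh u :&: ~: Q| + #|Q|.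
  by rewrite (leq_trans (hd u)) // -(cardsID Q) addnC setDE leq_add // subset_leq_card // subsetIr.
have [||| S1 [S1P cS1 tU1]] := cover_greedy esym eirr k3 rich (m := #|Bad|) (B := Bad :\: P0)
    (P := ~: (P0 :|: (Bad :\: P0))).
- by rewrite subset_leq_card // subsetDl.
- by set_tac.
- move=> u _; have := outside u (P0 :|: (Bad :\: P0)).
  have h1 : #|P0 :|: (Bad :\: P0)| <= #|P0| + #|Bad|.
    by rewrite (leq_trans (leq_card_setU _ _)) // leq_add2l subset_leq_card // subsetDl.
  by move: h1 cP0 hbad; clear; lia.
set U1 := Bad :\: P0 :|: S1 in tU1.
have cU1 : #|U1| <= #|Bad| * k.
  rewrite (leq_trans (leq_card_setU _ _)) // -[k in _ * k]prednK; last exact: leq_trans k3.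
  by rewrite mulnS leq_add // subset_leq_card // subsetDl.
have dU1 : [disjoint U1 & P0] by rewrite /U1; set_tac.
pose W := ~: (P0 :|: U1).
have [|//|//|U2 [U2W tU2 cL]] := almost_tiling esym eirr k3 rich (W := W) (D := D) (g := g).
  move=> u _; have := outside u (P0 :|: U1).
  have h1 : #|P0 :|: U1| <= #|P0| + #|U1| := leq_card_setU _ _.
  by move: h1 cP0 cU1 hD; rewrite -/W; clear; lia.
rewrite -/ell in cL; set L := W :\: U2 in cL.
have LBad : [disjoint L & Bad] by rewrite /L /W /U1; set_tac.
have [||| S2 [S2X cS2 tL]] := cover_greedy esym eirr k3 rich (m := ell) (B := L) (P := Xr).
- exact: cL.
- by rewrite /L /W /P0 /X; set_tac.
- by move=> u uL; apply: leq_trans hrho (hXr _ _); rewrite (disjointFr LBad).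
have [||E [x [y [Ek xy bal]]]] := @balance I f k k3 (fun l => #|S2 :&: class l|) (ell * k.-1) S.
- by move=> l; apply: leq_trans cS2; rewrite subset_leq_card // subsetIl.
- exact: hS.
have cSel l := card_selected des_prof des_disj l xy.
set DT := selected des x y in cSel.
have dS2DT : [disjoint S2 & DT] by have := selXr x y; rewrite -/DT => h; set_tac.
have DTX : DT \subset X by apply: selX.
pose R l := (X :\: (S2 :|: DT)) :&: class l.
(* Class [l] loses exactly [dl l - E l] vertices to [S2] and the selected tiles, so [E l < k]
   vertices too many remain for the absorbing set. *)
have cR l : #|R l| = #|X :&: class l| - dl l + E l.
  have e1 : #|X :&: class l| = #|R l| + (#|S2 :&: class l| + #|DT :&: class l|).
    rewrite -cards_disjU; last by set_tac.
    rewrite -cards_disjU; last by rewrite /R; set_tac.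
    by congr #|pred_of_set _|; rewrite /R /X; set_tac.
  by have := bal l; have := dlX l; rewrite -/(dl l) -cSel e1; clear; lia.
have [X' hX'] : exists X' : I -> {set T}, forall l, X' l \subset R l /\ #|X' l| = #|X :&: class l| - dl l.
  have /fin_all_exists// : forall l, exists B : {set T}, B \subset R l /\ #|B| = #|X :&: class l| - dl l.
  move=> l; have [|B BR cB] := @exists_subset_card T (#|X :&: class l| - dl l) (R l).
    by rewrite cR leq_addr.
  by exists B.
have dclass l l' : l != l' -> [disjoint class l & class l'].
  move=> ll'; apply/pred0P => z /=; rewrite !in_class; apply/negP => /andP[/eqP->].
  by rewrite (negbTE ll').
pose VX := \bigcup_l (A l :|: X' l).
have X'X l : X' l \subset X :&: class l by have [h1 _] := hX' l; rewrite /R in h1; set_tac.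
have tVX : tileable VX.
  apply: tileable_bigcup => [l _|l l' _ _ ll'].
    by have [_ _ tA] := A1 l; apply: tA; [exact: X'X | have [] := hX' l].
  have [d1 _ _] := A1 l; have [d2 _ _] := A1 l'; have d3 := A_disj _ _ ll'; have d4 := dclass _ _ ll'.
  have h1 := X'X l; have h2 := X'X l'; set_tac.
have AAVX : AA \subset VX.
  by apply/bigcupsP => l _; apply: (bigcup_max l) => //; rewrite subsetUl.
have VXP0 : VX \subset P0.
  apply/bigcupsP => l _; have h1 := X'X l; have h2 : A l \subset AA by apply: bigcup_sup.
  by rewrite /P0; set_tac.
have dVX : [disjoint VX & S2 :|: DT].
  rewrite disjoint_sym; apply: bigcup_disjoint => l _; have [d1 _ _] := A1 l.
  by have [h1 _] := hX' l; rewrite /R in h1; rewrite /X in d1 DTX; set_tac.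
exists (U1 :|: (U2 :|: ((L :|: S2) :|: (DT :|: VX)))).
  have dDV : [disjoint DT & VX] by set_tac.
  have dLV : [disjoint L :|: S2 & DT :|: VX] by rewrite /L /W; rewrite /P0 in VXP0 *; set_tac.
  apply: tileable_setU => //; last first.
    by rewrite /L /W in U2W dU1 *; rewrite /P0 /X in U2W VXP0 dU1 DTX *; set_tac.
  apply: tileable_setU => //; last first.
    by rewrite /L /W in U2W dU1 *; rewrite /P0 /X in U2W VXP0 dU1 DTX *; set_tac.
  apply: tileable_setU => //; apply: tileable_setU => //.
  exact: tileable_selected.
(* Nothing outside [X] is left uncovered, and in each class only the surplus of [R l] over [X' l]
   is. *)
have sub : ~: (U1 :|: (U2 :|: ((L :|: S2) :|: (DT :|: VX)))) \subset \bigcup_l (R l :\: X' l).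
  have h : ~: (U1 :|: (U2 :|: ((L :|: S2) :|: (DT :|: VX)))) \subset X :\: (S2 :|: DT) :\: VX.
    by rewrite /L /W /P0; set_tac.
  apply: subset_trans h _; apply/subsetP => z; rewrite in_setD => /andP[zV zX].
  apply/bigcupP; exists (cls z) => //; rewrite in_setD /R in_setI zX in_class eqxx !andbT.
  apply: contra zV => zX'; apply/bigcupP; exists (cls z) => //.
  by rewrite in_setU zX' orbT.
apply: leq_trans (subset_leq_card sub) _; apply: leq_trans (card_bigcup_leq _ _) _.
rewrite -sum_nat_const; apply: leq_sum => l _; have [h1 h2] := hX' l.
by rewrite cardsDS // cR h2; have := Ek l; clear; lia.
Qed.

End Assembly.

(** * Constants *)

Section Links.
Variables (T : finType) (e : rel T).
Hypothesis esym : symmetric e.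
Local Notation neigh := (neigh e).

(** Adding one vertex to a set of $m$ loses at most $mb$ to overlaps, and $m^2 + m \le (m+1)^2$. *)
Lemma bonferroni b (S : {set T}) :
    {in S &, forall x y, x != y -> #|neigh x :&: neigh y| <= b} ->
  \sum_(x in S) #|neigh x| <= #|\bigcup_(x in S) neigh x| + #|S| ^ 2 * b.
Proof.
move: {2}#|S| (erefl #|S|) => m; elim: m S => [|m IH] S cS hS.
  by move/eqP: cS; rewrite cards_eq0 => /eqP->; rewrite !big_set0.
have [x xS] : exists x, x \in S by apply/set0Pn; rewrite -card_gt0 cS.
have cS' : #|S :\ x| = m by have := cardsD1 x S; rewrite xS cS; clear; lia.
have hS' : {in S :\ x &, forall y z, y != z -> #|neigh y :&: neigh z| <= b}.
  by move=> y z; rewrite !in_setD1 => /andP[_ yS] /andP[_ zS]; apply: hS.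
have := IH _ cS' hS'; rewrite cS' cS !(big_setD1 x xS) /=.
set V := \bigcup_(i in S :\ x) _ => hV.
have hI : #|neigh x :&: V| <= m * b.
  rewrite /V big_distrr /=; apply: leq_trans (card_bigcup_leq _ _) _.
  rewrite -cS' -sum_nat_const; apply: leq_sum => y; rewrite in_setD1 => /andP[yx yS].
  by apply: hS; rewrite // eq_sym.
have := cardsUI (neigh x) V; move: hV hI; rewrite -!mulnn; clear; nia.
Qed.

(** Otherwise $q+1$ neighbourhoods with small overlaps would cover more than $n$ vertices, as
    $(q+1)d \ge (1+1/g)n$. *)
Lemma link_pair q b d g (S : {set T}) : (forall x, d <= #|neigh x|) ->
    g.+1 * #|T| <= g * q.+1 * d -> g * q.+1 ^ 2 * b < #|T| -> #|S| = q.+1 ->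
  exists x y, [/\ x \in S, y \in S, x != y & link e b 0 x y].
Proof.
move=> hd hg hb cS.
have [/existsP[x /existsP[y /and4P[xS yS xy lk]]]|none] := boolP [exists x, exists y,
  [&& x \in S, y \in S, x != y & link e b 0 x y]]; first by exists x, y.
exfalso; have : {in S &, forall x y, x != y -> #|neigh x :&: neigh y| <= b}.
  move=> x y xS yS xy; move: none; rewrite negb_exists => /forallP/(_ x); rewrite negb_exists => /forallP/(_ y).
  by rewrite xS yS xy /= -ltnNge => /ltnW.
have h1 : q.+1 * d <= \sum_(x in S) #|neigh x|.
  by rewrite -cS -sum_nat_const; apply: leq_sum => x _.
have h2 : #|\bigcup_(x in S) neigh x| <= #|T| := max_card _.
move=> /bonferroni h3; have h4 : q.+1 * d <= #|T| + q.+1 ^ 2 * b.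
  by rewrite (leq_trans h1) // (leq_trans h3) // cS leq_add2r.
have h5 := leq_mul (leqnn g) h4; rewrite mulnDr [g * (_ * d)]mulnA [g * (_ ^ 2 * b)]mulnA in h5.
by move: h5 hg hb; move: (g * q.+1 * d) (g * q.+1 ^ 2 * b) #|T| => u v w; rewrite mulSn; move: (g * w) => z; clear; lia.
Qed.

(** There are at least $d^2$ walks of length two from $x$. Vertices that are not linked to $x$
    receive at most $b$ each, linked ones at most $n$. *)
Lemma many_links b h d k x : (forall x, d <= #|neigh x|) -> #|T| <= k * d ->
    k ^ 2 * (h + b) <= #|T| -> h <= #|[set y | link e b 0 x y]|.
Proof.
move=> hd hkd hb; have T0 : 0 < #|T| by apply/card_gt0P; exists x.
have dc : \sum_(y in setT) #|neigh y :&: neigh x| = \sum_(y in neigh x) #|neigh y :&: setT|.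
  exact: double_count.
have l1 : d * d <= \sum_(y in neigh x) #|neigh y :&: setT|.
  apply: leq_trans (_ : \sum_(y in neigh x) d <= _); first by rewrite sum_nat_const leq_mul2r hd orbT.
  by apply: leq_sum => y _; rewrite setIT.
set H := [set y | _].
have l2 : \sum_(y in setT) #|neigh y :&: neigh x| <= #|H| * #|T| + #|T| * b.
  rewrite (bigID (mem H)) /= leq_add //.
    rewrite -sum_nat_const (eq_bigl (mem H)) => [|y]; last by rewrite in_setT.
    by apply: leq_sum => y _; apply: max_card.
  rewrite -cardsT -sum_nat_const big_mkcondr /=; apply: leq_sum => y _.
  by case: ifP => //; rewrite /H inE /= -ltnNge setIC => /ltnW.
rewrite dc in l2; have l3 := leq_trans l1 l2.
rewrite -(leq_add2r b) -(leq_pmul2r T0).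
have k0 : 0 < k ^ 2 by rewrite expn_gt0; case: (k) hkd T0 => //; rewrite mul0n; lia.
rewrite -(leq_pmul2l k0) mulnA.
apply: leq_trans (leq_mul hb (leqnn _)) _; apply: leq_trans (leq_mul hkd hkd) _.
have -> : k * d * (k * d) = k ^ 2 * (d * d) by ring.
by rewrite leq_mul2l mulnDl [b * _]mulnC l3 orbT.
Qed.

End Links.

(** All parameters are linear in $s = \lfloor n/C_n \rfloor$: $x_b = C_xs$, $m = C_ms$ and $b =
    4qkm$, with $C_n$ so large that $C_1b \le n$. The conditions involving $a$ follow from $A_0a +
    A_1 \le s$, which [Big] and [N] enforce. The factor 4 in $b$ leaves room for sums of three terms
    of size at most $m$. *)
Lemma exists_constants k q g t sl K ts : 3 <= k -> 0 < q -> 0 < g ->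
  exists Big N, forall n a, N <= n -> Big * a <= n -> exists s m b xb,
    [/\ b = q * k * m * 4, 0 < m, a <= m, sl <= m & g * q.+1 ^ 2 * b < n] /\
    [/\ k ^ 2 * (q * q * b + q * b + b + b) <= n, 4 * k * g * m <= n, 32 * k ^ 2 * s <= n,
      t * (8 * k * s) + q * 2 * s.*2 * k <= xb &
      xb + q * (ts * xb) + (xb + ts * xb + k * (K + 3)) <= m] /\
    (a + 2 * k * (2 * g) * (a + k) * k.-1 < s /\
     q * (k * (k - 2)) ^ 2 + (2 * k * (2 * g) * (a + k) * k.-1).+1 * k <= s).
Proof.
move=> k3 q0 g0; pose Cx := 8 * k * t + 4 * q * k.
have [Cm [hCm Cmsl Cm0]] : exists Cm,
    [/\ Cx * (2 + q.+1 * ts) + k * (K + 3) <= Cm, sl <= Cm & 0 < Cm].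
  by exists (Cx * (2 + q.+1 * ts) + k * (K + 3) + sl + 1); split; lia.
have [C1 [C1a C1b C1c C1d]] : exists C1,
    [/\ g * q.+1 ^ 2 + 1 <= C1, k ^ 2 * (q * q + q + 2) <= C1, g <= C1 & 8 * k ^ 2 <= C1].
  by exists (g * q.+1 ^ 2 + 1 + k ^ 2 * (q * q + q + 2) + g + 8 * k ^ 2); split; lia.
have [Cn eCn] : exists Cn, Cn = C1 * (q * k * Cm * 4) by eexists.
have [A0 eA0] : exists A0, A0 = 4 * k ^ 3 * g + 1 by eexists.
have [A1 eA1] : exists A1, A1 = q * k ^ 4 + 4 * k ^ 4 * g + k + 1 by eexists.
have Cn0 : 0 < Cn.
  by rewrite eCn muln_gt0 (leq_trans g0 C1c) muln_gt0 andbT muln_gt0 Cm0 andbT muln_gt0 q0 (ltn_trans _ k3).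
exists (4 * Cn * A0), (2 * A1 * Cn + Cn) => n a hN hBig.
pose s := n %/ Cn.
have sn : Cn * s <= n by rewrite mulnC leq_divM.
have s0 : 0 < s by rewrite divn_gt0 // (leq_trans _ hN) // leq_addl.
have ns : n <= 2 * Cn * s.
  have := ltn_ceil n Cn0; rewrite -/s mulSn => h1; apply: leq_trans (ltnW h1) _.
  by rewrite mulnC -mulnA mul2n -addnn leq_add2r leq_pmulr.
have sA1 : 2 * A1 <= s by rewrite leq_divRL // (leq_trans _ hN) // leq_addr.
have sA0 : 2 * (A0 * a) <= s.
  have c2 : 0 < 2 * Cn by rewrite muln_gt0.
  rewrite -(leq_pmul2l c2); apply: leq_trans ns; apply: leq_trans hBig.
  by rewrite (_ : 2 * Cn * _ = 4 * Cn * A0 * a) //; ring.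
have AA : A0 * a + A1 <= s by move: sA0 sA1; clear; lia.
clearbody s; clear hN hBig ns Cn0 sA0 sA1.
have as_ : a <= s.
  apply: leq_trans AA; rewrite (leq_trans _ (leq_addr _ _)) // eA0 leq_pmull //.
  by rewrite addn1.
have k0 : 0 < k by apply: leq_trans k3.
exists s, (Cm * s), (q * k * (Cm * s) * 4), (Cx * s).
set m := Cm * s; set b := q * k * m * 4.
have sm : s <= m by rewrite leq_pmull.
have mb : 4 * m <= b.
  by rewrite /b mulnC leq_mul2r leq_pmull ?muln_gt0 ?q0.
have bn : C1 * b <= n.
  by apply: leq_trans sn; rewrite eCn /b /m !mulnA [C1 * q * k * Cm * s * 4]mulnAC.
have b0 : 0 < b by apply: leq_trans mb; rewrite muln_gt0 /= (leq_trans s0 sm).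
split; [split=> //|split; [split|split]].
- exact: leq_trans s0 sm.
- exact: leq_trans as_ sm.
- by rewrite (leq_trans Cmsl) // leq_pmulr.
- apply: leq_trans bn; apply: leq_trans (leq_mul C1a (leqnn b)).
  by rewrite mulnDl mul1n -addn1 leq_add2l.
- apply: leq_trans bn; apply: leq_trans (leq_mul C1b (leqnn b)).
  by move: (k ^ 2) (b) => u v; clear; lia.
- apply: leq_trans bn; apply: leq_trans (leq_mul C1c (leqnn b)).
  have -> : 4 * k * g * m = g * (1 * (k * m * 4)) by ring.
  by rewrite /b -!mulnA leq_mul2l leq_mul2r q0 !orbT.
- apply: leq_trans bn; apply: leq_trans (leq_mul C1d (leqnn b)).
  have -> : 32 * k ^ 2 * s = 8 * k ^ 2 * (4 * s) by move: (k ^ 2) => u; clear; ring.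
  by rewrite leq_mul2l (leq_trans _ mb) ?orbT // leq_mul2l sm.
- by rewrite /Cx -!muln2; move: (s) => u; clear; lia.
- apply: leq_trans (leq_mul hCm (leqnn s)).
  have : k * (K + 3) <= k * (K + 3) * s by rewrite leq_pmulr.
  by rewrite mulnDl; move: (Cx) (k * (K + 3)) (s); clear; move=> x u v; nia.
- apply: leq_trans AA; rewrite eA0 eA1.
  have : 4 * k * g * (a + k) * k.-1 <= 4 * k * g * (a + k) * k ^ 2.
    by rewrite leq_mul2l (leq_trans (leq_pred _)) ?orbT // -mulnn leq_pmulr.
  rewrite (_ : 2 * k * (2 * g) = 4 * k * g); last by clear; ring.
  rewrite (_ : 4 * k * g * (a + k) * k ^ 2 = 4 * k ^ 3 * g * a + 4 * k ^ 4 * g); last by clear; ring.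
  by move: (_ * k.-1) => u; move: (4 * k ^ 3 * g) (4 * k ^ 4 * g) (q * k ^ 4) => x y z; clear; lia.
apply: leq_trans AA; rewrite eA0 eA1.
have h1 : (4 * k * g * (a + k) * k.-1).+1 * k <= 4 * k * g * (a + k) * k ^ 2 + k.
  by rewrite mulSn addnC leq_add2r -mulnA leq_mul2l -mulnn leq_mul2r leq_pred !orbT.
rewrite (_ : 2 * k * (2 * g) = 4 * k * g); last by clear; ring.
rewrite (_ : 4 * k * g * (a + k) * k ^ 2 = 4 * k ^ 3 * g * a + 4 * k ^ 4 * g) in h1; last by clear; ring.
have h2 : q * (k * (k - 2)) ^ 2 <= q * k ^ 4.
  have -> : k ^ 4 = (k * k) ^ 2 by clear; ring.
  by rewrite leq_mul2l leq_exp2r // leq_mul2l leq_subr !orbT.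
by move: h1 h2; move: (_.+1 * k) (q * _ ^ 2) => u v; move: (4 * k ^ 3 * g) (4 * k ^ 4 * g) (q * k ^ 4) => x y z; clear; lia.
Qed.

Section MainNat.
Variables (k q g : nat).
Hypotheses (k3 : 3 <= k) (q0 : 0 < q) (g0 : 0 < g).

Lemma tiling_from_constants (T : finType) (e : rel T) (a d t s m b xb : nat) :
    symmetric e -> irreflexive e ->
    (forall U : {set T}, a < #|U| -> exists A : {set T}, [/\ A \subset U, #|A| = k.-1 & clique e A]) ->
    (forall x, d <= #|neigh e x|) ->
    g.+1 * #|T| <= k * g * d -> g.+1 * #|T| <= g * q.+1 * d ->
    4 * k ^ 2 * g * (8 * k).-1 ^ t <= (8 * k) ^ t ->
    b = q * k * m * 4 -> 0 < m -> a <= m -> gadget_slack k q.+1 <= m ->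
    g * q.+1 ^ 2 * b < #|T| -> k ^ 2 * (q * q * b + q * b + b + b) <= #|T| ->
    4 * k * g * m <= #|T| -> 32 * k ^ 2 * s <= #|T| ->
    t * (8 * k * s) + q * 2 * s.*2 * k <= xb ->
    xb + q * (template_size k (gadget_size k q.+1) * xb) +
      (xb + template_size k (gadget_size k q.+1) * xb + k * (gadget_size k q.+1 + 3)) <= m ->
    a + 2 * k * (2 * g) * (a + k) * k.-1 < s ->
    q * (k * (k - 2)) ^ 2 + (2 * k * (2 * g) * (a + k) * k.-1).+1 * k <= s ->
  exists2 U : {set T}, tileable e k U & #|~: U| <= q * k.-1.
Proof.
set n := #|T|; set K := gadget_size k q.+1; set ts := template_size k K.
move=> esym eirr rich hd hk hq ht qkm m0 am slm hb1 hb2 hbig h32 hxb hm hrho hS.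
have k0 : 0 < k by clear -k3; lia.
have b0 : 0 < b by rewrite qkm muln_gt0 andbT muln_gt0 m0 andbT muln_gt0 q0.
have n0 : 0 < n by apply: leq_trans hb1.
have hkd : n <= k * d.
  rewrite -(leq_pmul2l g0); have -> : g * (k * d) = k * g * d by rewrite mulnCA mulnA.
  by apply: leq_trans hk; rewrite mulSn leq_addl.
have [S [cls [cS clsS clsL bigS]]] : exists (S : {set T}) (cls : T -> T), [/\ #|S| <= q,
    forall x, cls x \in S, forall x y, cls x = cls y -> link e b q.+1 x y &
    forall s, s \in S -> b <= #|[set x | cls x == s]|].
  apply: (link_partition (h := q * q * b + q * b + b)) => //.
  - by move=> S; apply: link_pair hd hq hb1.
  - move=> x /=; rewrite setIid (leq_trans _ (hd x)) //.
    rewrite -(leq_pmul2l k0); apply: leq_trans hkd; apply: leq_trans hb2.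
    by rewrite -mulnn -mulnA leq_pmul2l // (leq_trans (leq_addl (q * q * b + q * b + b) b)) // leq_pmull.
  by move=> x; apply: (many_links esym x hd hkd hb2).
pose I := {x : T | x \in S}.
have cI : #|{: I}| <= q by rewrite card_sig.
pose clsI x : I := exist _ (cls x) (clsS x).
have swaps u v : clsI u = clsI v -> swap e k K m u v.
  move=> /(congr1 val) /= /clsL lk; apply: (link_swap esym eirr k3 rich lk).
  rewrite qkm; apply: leq_ltn_trans (_ : m * 3 < _); first by move: am slm; clear; lia.
  have : 1 <= q * k by rewrite muln_gt0 q0.
  by move: (q * k) m0 => x; clear; nia.
have big_classes i : b <= #|class clsI i|.
  by rewrite (leq_trans (bigS _ (valP i))) // subset_leq_card //.
have mb : m <= b by rewrite qkm; move: (muln_gt0 q k); rewrite q0 k0; move: (q * k) => x; clear; nia.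
have [f hf] : exists f : I -> I, forall i, mixed_tiles e k clsI m i (f i) /\ mixed_tiles e k clsI m (f i) i.
  have /fin_all_exists// : forall i : I, exists j, mixed_tiles e k clsI m i j /\ mixed_tiles e k clsI m j i.
  move=> i; apply: (exists_mixed_tiles esym eirr k3 rich hd).
  rewrite -(ltn_pmul2l k0) -/n.
  apply: leq_trans (_ : b * n <= _); last first.
    rewrite mulnCA leq_mul //.
  rewrite qkm !mulnA ltn_pmul2r //.
  apply: leq_ltn_trans (_ : k * q * (m * 3) < _).
    by apply: leq_mul; [rewrite leq_mul2l cI orbT | move: am; clear; lia].
  by move: (muln_gt0 q k); rewrite q0 k0 [k * q]mulnC; move: (q * k) m0 => x; clear; nia.
have deg x : #|T| <= k * #|neigh e x| by rewrite (leq_trans hkd) // leq_mul2l hd orbT.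
have [||Xr [cXr hXr]] := @reservoir T e k esym k3 s t.
- exact: deg.
- exact: h32.
set Bad := [set u | _] in hXr.
(* The number [t] of reservoir steps makes the exceptional set this small. *)
have cBad : 4 * k ^ 2 * g * #|Bad| <= n.
  have p0 : 0 < (8 * k) ^ t by rewrite expn_gt0 muln_gt0 k0.
  rewrite -(leq_pmul2l p0); move: ht hXr; rewrite -/n.
  move: ((8 * k) ^ t) ((8 * k).-1 ^ t) (4 * k ^ 2 * g) #|Bad| (n); clear => x y z u v h1 h2.
  rewrite mulnCA; apply: leq_trans (leq_mul (leqnn z) h2) _.
  by rewrite mulnA leq_mul2r h1 orbT.
have cm : xb + #|{: I}| * (ts * xb) + (xb + ts * xb + k * (K + 3)) <= m.
  by apply: leq_trans hm; rewrite leq_add2r leq_add2l leq_mul2r cI orbT.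
have cm' : xb + #|{: I}| * (ts * xb) <= m by apply: leq_trans cm; apply: leq_addr.
have loss : k * (2 * m + #|Bad| * k) < n.
  move: cBad hbig n0 g0; rewrite -mulnn; move: (n) #|Bad|; clear => u v.
  by move=> h1 h2 h3 h4; nia.
have loss' : 2 * m + #|Bad| * k < d by rewrite -(ltn_pmul2l k0) (leq_trans loss).
(* At most half of the surplus $n/g$ in $kd$ is lost to the vertices set aside, so the remaining
   degree keeps a surplus with $2g$ in place of $g$. *)
have [||||||||||U tU cU] := @assembly T e k a esym eirr k3 rich I clsI K m f swaps
  (fun i => (hf i).1) (fun i => (hf i).2) (fun i => leq_trans mb (big_classes i))
  Xr Bad s (2 * g) (d - (m + #|Bad| * k)) d s xb; last first.
- by exists U; rewrite // (leq_trans cU) // leq_mul2r cI orbT.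
- by apply: leq_trans hS; rewrite leq_add2r leq_mul2r cI orbT.
- exact: hrho.
- apply: leq_trans hbig; have -> : 2 * k * (2 * g) * a = 4 * k * g * a by clear; ring.
  by rewrite leq_mul2l am orbT.
- rewrite -/n; move: cBad hbig hk loss'; rewrite -mulnn; move: (n) #|Bad|; clear => u v.
  move=> h1 h2 h3 h4.
  have e1 : d = d - (m + v * k) + (m + v * k) by lia.
  rewrite e1 in h3; move: (d - _) h3 => D h3; nia.
- rewrite -/ts; move: loss' cm'; move: (#|{: I}| * _) (#|Bad| * k); clear; lia.
- rewrite -/ts; move: loss' cm' am; rewrite -{1}(prednK k0) mulnS.
  move: (#|{: I}| * _) (#|Bad| * k.-1) #|Bad|; clear; lia.
- exact: cm.
- by apply: leq_trans hxb; rewrite leq_add // leq_mul2r leq_mul2r leq_mul2r cI !orbT.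
- exact: hd.
by move=> u; rewrite inE -leqNgt.
Qed.

Theorem tiling_nat : exists Big N : nat, forall (T : finType) (e : rel T) (a d : nat),
    symmetric e -> irreflexive e ->
    (forall U : {set T}, a < #|U| -> exists A : {set T}, [/\ A \subset U, #|A| = k.-1 & clique e A]) ->
    (forall x, d <= #|neigh e x|) ->
    N <= #|T| -> Big * a <= #|T| -> g.+1 * #|T| <= k * g * d -> g.+1 * #|T| <= g * q.+1 * d ->
  exists2 U : {set T}, tileable e k U & #|~: U| <= q * k.-1.
Proof.
have k8 : 0 < (8 * k).-1 by move: k3; clear; lia.
have [t ht] := exists_expn_ratio (4 * k ^ 2 * g) k8.
rewrite prednK in ht; last by rewrite muln_gt0 (ltn_trans _ k3).
have [Big [N hBN]] := exists_constants t (gadget_slack k q.+1) (gadget_size k q.+1)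
  (template_size k (gadget_size k q.+1)) k3 q0 g0.
exists Big, N => T e a d esym eirr rich hd hN hBig hk hq.
have [s [m [b [xb [[h1 h2 h3 h4 h5] [[h6 h7 h8 h9 h10] [h11 h12]]]]]]] := hBN #|T| a hN hBig.
exact: tiling_from_constants esym eirr rich hd hk hq ht h1 h2 h3 h4 h5 h6 h7 h8 h9 h10 h11 h12.
Qed.

End MainNat.

(** * The theorem for simple graphs *)

Section SimpleGraphs.
Variable G : sgraph.

Lemma min_degree_leq (x : G) : min_degree G <= #|neigh (@adj G) x|.
Proof.
rewrite -/(degree x) /min_degree; move: (mem_index_enum x).
elim: (index_enum _) => //= y s IH; rewrite in_cons big_cons => /predU1P[->|/IH h].
  exact: geq_minl.
exact: leq_trans (geq_minr _ _) h.
Qed.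

Lemma alpha_num_rich r (U : {set G}) : alpha_num r G < #|U| ->
  exists A : {set G}, [/\ A \subset U, #|A| = r & clique (@adj G) A].
Proof.
move=> ltU; have [/existsP[f /andP[/injectiveP fi fadj]]|free] :=
    boolP (contains_copy (complete r) (induced U)); last first.
  move: ltU; rewrite ltnNge /alpha_num.
  by rewrite (leq_bigmax_cond (F := fun U : {set G} => #|U|) U free).
exists [set val (f i) | i in [set: 'I_r]]; split.
- by apply/subsetP => _ /imsetP[i _ ->]; apply: valP.
- by rewrite card_imset ?cardsT ?card_ord // => i j /val_inj/fi.
apply/cliqueP => _ _ /imsetP[i _ ->] /imsetP[j _ ->] fij.
have /forallP/(_ i)/forallP/(_ j)/implyP := fadj.
by apply; apply: contraNneq fij => ->.
Qed.

(** On a clique every bijection preserves adjacency, which is why one clique tiling serves all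
    graphs [F] with [k] vertices. *)
Lemma tile_copy k (F : sgraph) (A : {set G}) : 0 < k -> #|F| = k -> tile (@adj G) k A ->
  exists f : {ffun F -> G}, is_copy f /\ f @: [set: F] = A.
Proof.
move=> k0 cF /andP[/eqP cA /cliqueP clA].
have [x0 x0A] : exists x0, x0 \in A by apply/set0Pn; rewrite -card_gt0 cA.
have sA : size (enum A) = #|F| by rewrite -cardE cA cF.
pose f := [ffun x : F => nth x0 (enum A) (enum_rank x)].
have fi : injective f.
  move=> x y; rewrite !ffunE => /eqP.
  by rewrite nth_uniq ?enum_uniq ?sA ?ltn_ord // => /eqP/val_inj/enum_rank_inj.
have fA x : f x \in A by rewrite ffunE -mem_enum mem_nth // sA ltn_ord.
exists f; split.
  apply/andP; split; first exact/injectiveP.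
  apply/forallP => x; apply/forallP => y; apply/implyP => xy; apply: clA => //.
  by apply: contraTneq xy => /fi ->; rewrite adj_irrefl.
apply/eqP; rewrite eqEcard card_imset // cardsT cF cA leqnn andbT.
by apply/subsetP => _ /imsetP[x _ ->].
Qed.

Lemma tileable_tiling k (F : sgraph) (U : {set G}) : 0 < k -> #|F| = k ->
  tileable (@adj G) k U ->
  exists2 M : {set {ffun F -> G}}, is_tiling M & covered M = U.
Proof.
move=> k0 cF; elim=> [|A B tA dAB _ [M [Mcopy Mdis] covM]].
  by exists set0; [split=> f; rewrite inE | rewrite /covered big_set0].
have [f [fcopy fA]] := tile_copy k0 cF tA.
have MB g : g \in M -> g @: [set: F] \subset B.
  by move=> gM; rewrite -covM /covered (bigcup_max g).
exists (f |: M).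
  split=> [g|g h]; rewrite !in_setU1; first by case/predU1P=> [->|/Mcopy].
  case/predU1P=> [->|gM] /predU1P[->|hM] //; rewrite ?eqxx //.
  - by move=> _; rewrite fA (disjointWr (MB h hM)).
  - by move=> _; rewrite fA disjoint_sym (disjointWr (MB g gM)).
  exact: Mdis.
have fM : f \notin M.
  apply/negP => /MB; rewrite fA => AB; have := disjoint_setI0 dAB; rewrite (setIidPl AB) => A0.
  by case/andP: tA; rewrite A0 cards0 eq_sym => /eqP k00; rewrite k00 in k0.
by rewrite /covered bigcup_setU big_set1 fA -covM.
Qed.

End SimpleGraphs.

Import Order.TTheory GRing.Theory Num.Theory.

Local Open Scope ring_scope.

Theorem theorem1p7 (R : realType) (k : nat) (eta : R)
    (hk : (3 <= k)%N) (heta : 1 / k%:R < eta) (heta1 : eta <= 1) :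
  exists2 alpha : R, 0 < alpha &
  exists N : nat, forall n : nat, (N <= n)%N ->
  forall G : sgraph, #|G| = n ->
    eta * n%:R <= (min_degree G)%:R ->
    (alpha_num (k - 1) G)%:R <= alpha * n%:R ->
    has_quasiperfect_tiling eta (complete k) G /\
    (forall F : sgraph, #|F| = k -> has_quasiperfect_tiling eta F G).
Proof.
have k0 : (0 < k)%N by apply: leq_trans hk.
have kR : 0 < k%:R :> R by rewrite ltr0n.
have eta0 : 0 < eta by apply: lt_trans heta; rewrite divr_gt0.
set q := Num.truncn (1 / eta).
have /andP[q1 q2] : q%:R <= 1 / eta < q.+1%:R by apply: truncn_itv; rewrite divr_ge0 // ltW.
have q0 : (0 < q)%N by rewrite truncn_gt0 ler_pdivlMr // mul1r.
have gap1 : 0 < k%:R * eta - 1.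
  by rewrite subr_gt0 mulrC -ltr_pdivrMr.
have gap2 : 0 < q.+1%:R * eta - 1 by rewrite subr_gt0 -ltr_pdivrMr.
(* [g] turns the two strict inequalities $k\eta > 1$ and $(q+1)\eta > 1$ into surpluses of at least
   $1/g$, the form needed for natural numbers. *)
pose g1 := (Num.truncn (k%:R * eta - 1)^-1).+1; pose g2 := (Num.truncn (q.+1%:R * eta - 1)^-1).+1.
pose g := maxn g1 g2.
have gapP (x : R) (m : nat) : 0 < x -> ((Num.truncn x^-1).+1 <= m)%N -> 1 <= m%:R * x.
  move=> x0 hm; rewrite -ler_pdivrMr // mul1r.
  apply: le_trans (ltW (truncnS_gt _)) _; by rewrite ler_nat.
have hg1 : 1 <= g%:R * (k%:R * eta - 1) by apply: gapP => //; apply: leq_maxl.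
have hg2 : 1 <= g%:R * (q.+1%:R * eta - 1) by apply: gapP => //; apply: leq_maxr.
have g0 : (0 < g)%N by rewrite leq_max.
have [Big [N hBN]] := tiling_nat hk q0 g0.
exists Big.+1%:R^-1; first by rewrite invr_gt0 ltr0n.
exists N => n hn G cG hdeg halpha.
(* Used with $c = k$ for the almost perfect tiling and with $c = q+1$ for the classes. *)
have degP c : 1 <= g%:R * (c%:R * eta - 1) -> (g.+1 * n <= c * g * min_degree G)%N.
  move=> hc; rewrite -(ler_nat R) !natrM -natr1.
  apply: le_trans (_ : c%:R * g%:R * (eta * n%:R) <= _); last by rewrite ler_wpM2l // mulr_ge0.
  rewrite mulrA ler_wpM2r //; lra.
have [||||||||U tU cU] := hBN G (@adj G) (alpha_num (k - 1) G) (min_degree G).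
- exact: adj_sym.
- exact: adj_irrefl.
- by move=> U /alpha_num_rich; rewrite subn1.
- exact: min_degree_leq.
- by rewrite cG.
- rewrite cG -(ler_nat R) natrM.
  have : Big.+1%:R * (alpha_num (k - 1) G)%:R <= n%:R :> R by rewrite -ler_pdivlMl // ltr0n.
  by apply: le_trans; rewrite ler_wpM2r // ler_nat.
- by rewrite cG; apply: degP.
- by rewrite cG [(g * _)%N]mulnC; apply: degP.
have final (F : sgraph) : #|F| = k -> has_quasiperfect_tiling eta F G.
  move=> cF; have [M tM cM] := tileable_tiling k0 cF tU; exists M => //.
  by rewrite /quasiperfect cM cF subn1.
by split=> //; apply: final; rewrite card_ord.
Qed.
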